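(* Let $n,d\ge 1$ and let $\mathcal G=\mathbb Z/d\mathbb Z\wr\mathfrak S_n$. Fix a $d$-partition $\boldsymbol\lambda=(\lambda^0,\dotsc,\lambda^{d-1})\vdash n$, and let $a_k=|\lambda^k|$ for $k=0,\dotsc,d-1$. Fix a sequence $\boldsymbol\beta=(\beta_0,\dotsc,\beta_{d-1})\in\{1,\epsilon\}^d$ of one-dimensional symmetric group characters ($1$ trivial, $\epsilon$ sign), and for $k=0,\dotsc,d-1$ let $\beta_k^{\lambda^k}=\beta_k\big\uparrow_{\mathfrak S_{\lambda^k}}^{\mathfrak S_{a_k}}$ be the character of $\mathfrak S_{a_k}$ induced from the restriction of $\beta_k$ to the Young subgroup $\mathfrak S_{\lambda^k}$. Let $\boldsymbol\beta^{\boldsymbol\lambda}=(\delta_0\beta_0\otimes\cdots\otimes\delta_{d-1}\beta_{d-1})\big\uparrow_{\mathcal G(\boldsymbol\lambda)}^{\mathcal G}$ be the corresponding monomial character of $\mathcal G$. Then $$\mathrm{Imm}^{\mathcal G}_{\boldsymbol\beta^{\boldsymbol\lambda}}(x)=\sum_{(I_0,\dotsc,I_{d-1})}\mathrm{Imm}_{\beta_0^{\lambda^0}}\big(Q_0(x)_{I_0,I_0}\big)\cdots\mathrm{Imm}_{\beta_{d-1}^{\lambda^{d-1}}}\big(Q_{d-1}(x)_{I_{d-1},I_{d-1}}\big),$$ where the sum is over all ordered set partitions $(I_0,\dotsc,I_{d-1})$ of $[n]$ of type $(a_0,\dotsc,a_{d-1})$.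
   Context: Set $[n]=\{1,\dotsc,n\}$ and fix a primitive complex $d$th root of unity $\zeta$. **The group.** $\mathcal G=\mathbb Z/d\mathbb Z\wr\mathfrak S_n$ is generated by $s_1,\dotsc,s_{n-1},t$ subject to $s_i^2=e$; $t^d=e$; $ts_1ts_1=s_1ts_1t$; $s_is_j=s_js_i$ for $|i-j|\ge2$; $ts_j=s_jt$ for $j\ge2$; $s_is_js_i=s_js_is_j$ for $|i-j|=1$. It acts (on the left) on the set of sequences $(\zeta^{\gamma_1}w_1,\dotsc,\zeta^{\gamma_n}w_n)$ with $w_1\cdots w_n\in\mathfrak S_n$ and $\gamma_i\in\mathbb Z/d\mathbb Z$ by: $s_i\circ(a_1,\dotsc,a_n)$ exchanges the entries in positions $i$ and $i+1$, and $t\circ(a_1,\dotsc,a_n)=(\zeta a_1,a_2,\dotsc,a_n)$. The map $g\mapsto g\circ(1,\dotsc,n)$ is a bijection from $\mathcal G$ to this set of sequences; the image $(g_1,\dotsc,g_n)$ is the one-line notation of $g$. The subgroup generated by $s_1,\dotsc,s_{n-1}$ is identified with $\mathfrak S_n$. **$d$-partitions.** A $d$-partition $\boldsymbol\lambda=(\lambda^0,\dotsc,\lambda^{d-1})\vdash n$ is a sequence of $d$ (possibly empty) integer partitions with $|\lambda^0|+\cdots+|\lambda^{d-1}|=n$ (superscripts are indices, not powers). Let $r_k=\ell(\lambda^k)$ be the number of parts of $\lambda^k=(\lambda^k_1,\dotsc,\lambda^k_{r_k})$. An ordered set partition of $[n]$ of type $(a_0,\dotsc,a_{m})$, where $a_0+\cdots+a_m=n$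 and $a_j\ge 0$, is a sequence $(I_0,\dotsc,I_m)$ of pairwise disjoint (possibly empty) subsets of $[n]$ with $|I_j|=a_j$. **Young subgroups of $\mathcal G$.** Let $K^0_1,\dotsc,K^0_{r_0},K^1_1,\dotsc,K^1_{r_1},\dotsc,K^{d-1}_1,\dotsc,K^{d-1}_{r_{d-1}}$ be the consecutive subintervals of $[n]$, in this order, with $|K^k_i|=\lambda^k_i$ (so $K^0_1=[1,\lambda^0_1]$, $K^0_2=[\lambda^0_1+1,\lambda^0_1+\lambda^0_2]$, etc.). Put $t_i=s_{i-1}\cdots s_1ts_1\cdots s_{i-1}$ and for $i\le j$ let $\mathcal G([i,j])$ be the subgroup generated by $t_i,s_i,\dotsc,s_{j-1}$ (isomorphic to $\mathbb Z/d\mathbb Z\wr\mathfrak S_{j-i+1}$). Let $\mathcal G(\boldsymbol\lambda,k)=\mathcal G(K^k_1)\cdots\mathcal G(K^k_{r_k})$ and $\mathcal G(\boldsymbol\lambda)=\mathcal G(\boldsymbol\lambda,0)\cdots\mathcal G(\boldsymbol\lambda,d-1)$; these are internal direct products, and each $y\in\mathcal G(\boldsymbol\lambda)$ factors uniquely as $y_0\cdots y_{d-1}$ with $y_k\in\mathcal G(\boldsymbol\lambda,k)$. **Monomial characters.** For $k=0,\dotsc,d-1$, let $\delta_k1=\delta_k$ and $\delta_k\epsilon$ be the one-dimensional characters of $\mathcal G$ given by $\delta_k:s_i\mapsto1,\ t\mapsto\zeta^k$ and $\delta_k\epsilon:s_i\mapsto-1,\ t\mapsto\zeta^k$. The character $\delta_0\beta_0\otimes\cdots\otimes\delta_{d-1}\beta_{d-1}$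 of $\mathcal G(\boldsymbol\lambda)$ is $y_0\cdots y_{d-1}\mapsto\prod_k(\delta_k\beta_k)(y_k)$ for $y_k\in\mathcal G(\boldsymbol\lambda,k)$. The symbol $\theta\big\uparrow_H^G$ denotes the induced character. **Variables and immanants.** Let $C_d[n]=\{\zeta^km: k\in\mathbb Z/d\mathbb Z,\ m\in[n]\}$ and let $x=\{x_{i,j}: i\in[n],\ j\in C_d[n]\}$ be a set of $dn^2$ commuting variables. For $g\in\mathcal G$ with one-line notation $(g_1,\dotsc,g_n)$ put $x^{e,g}=x_{1,g_1}\cdots x_{n,g_n}$. For $\theta:\mathcal G\to\mathbb C$, the type-$\mathcal G$ $\theta$-immanant is $$\mathrm{Imm}^{\mathcal G}_\theta(x)=\sum_{g\in\mathcal G}\theta(g^{-1})\,x^{e,g}\in\mathbb C[x].$$ For an $m\times m$ matrix $z=(z_{i,j})$ and a function $\theta:\mathfrak S_m\to\mathbb C$, the ordinary immanant is $\mathrm{Imm}_\theta(z)=\sum_{w\in\mathfrak S_m}\theta(w)z_{1,w_1}\cdots z_{m,w_m}$; for $m=0$ the immanant (of the empty matrix, with the trivial character of $\mathfrak S_0$) is $1$. For $k=0,\dotsc,d-1$, $Q_k(x)$ is the $n\times n$ matrix with $(i,j)$ entry $$q_{i,j,k}(x)=x_{i,j}+\zeta^{-k}x_{i,\zeta j}+\zeta^{-2k}x_{i,\zeta^2j}+\cdots+\zeta^{-(d-1)k}x_{i,\zeta^{d-1}j},$$ and $Q_k(x)_{I,I}$ is its submatrix with rows and columns indexed by $I\subseteq[n]$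 (in increasing order). *)

(* Defs.v *)
From HB Require Import structures.
From mathcomp Require Import all_boot all_order all_algebra all_fingroup.
From mathcomp Require Import all_solvable all_field all_character.
From mathcomp Require Import mpoly.

Set Implicit Arguments.
Unset Strict Implicit.
Unset Printing Implicit Defensive.

Import GRing.Theory.

(* Positions and letters are 0-based.  The parameters d n : nat stand for     *)
(* d - 1 and n - 1, so that d, n >= 1; 'I_d.+1 carries the additive group of  *)
(* Z/(d.+1)Z for every d, whereas 'Z_1 would be Z/2Z.                         *)
(* All roots of unity and character values are algebraic, so algC serves as   *)
(* the field of complex numbers.                                              *)

(* The pair (c, m) stands for the formal element zeta^c m of C_d[n] *)
Notation colored d n := ('I_d.+1 * 'I_n.+1)%type.

(** The wreath product of Z/(d.+1)Z and S_(n.+1) *)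

(* Wreath c w is the element with one-line notation                           *)
(*   (zeta^(c 0) (w 0), ..., zeta^(c n) (w n))                                *)
Record wreath (d n : nat) : Type :=
  Wreath { color : {ffun 'I_n.+1 -> 'I_d.+1}; under : 'S_n.+1 }.

Section WreathGroup.
Variables d n : nat.
Local Notation W := (wreath d n).

Definition wreath_pair (g : W) := (color g, under g).
Definition pair_wreath (p : {ffun 'I_n.+1 -> 'I_d.+1} * 'S_n.+1) : W :=
  Wreath p.1 p.2.
Lemma wreath_pairK : cancel wreath_pair pair_wreath. Proof. by case. Qed.
HB.instance Definition _ := Finite.copy W (can_type wreath_pairK).

(* The left action of g on sequences of colored letters permutes and scales   *)
(* positions: (g o a)_i = zeta^(color g i) a_(under g i).  As (g h) o (1..n)  *)
(* = g o (h o (1..n)), this yields the product below.  Permutations compose   *)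
(* from left to right in MathComp: (v * w) i = w (v i).                       *)
Definition wreath_mul (g h : W) : W :=
  Wreath [ffun i => color g i + color h (under g i)]%R (under g * under h)%g.
Definition wreath_one : W := Wreath [ffun=> 0%R] 1%g.
Definition wreath_inv (g : W) : W :=
  Wreath [ffun i => - color g ((under g)^-1%g i)]%R (under g)^-1%g.

Lemma wreath_eq (g h : W) :
  color g =1 color h -> under g = under h -> g = h.
Proof. by case: g h => [c w] [c' w'] /= /ffunP -> ->. Qed.

Lemma wreath_mulA : associative wreath_mul.
Proof.
move=> g h k; apply: wreath_eq => [i|] /=; last by rewrite mulgA.
by rewrite !ffunE permM addrA.
Qed.
Lemma wreath_mul1 : left_id wreath_one wreath_mul.
Proof.
move=> g; apply: wreath_eq => [i|] /=; last by rewrite mul1g.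
by rewrite !ffunE perm1 add0r.
Qed.
Lemma wreath_mulV : left_inverse wreath_one wreath_inv wreath_mul.
Proof.
move=> g; apply: wreath_eq => [i|] /=; last by rewrite mulVg.
by rewrite !ffunE addNr.
Qed.
HB.instance Definition _ :=
  Finite_isGroup.Build W wreath_mulA wreath_mul1 wreath_mulV.

Lemma colorM (g h : W) i : color (g * h)%g i = (color g i + color h (under g i))%R.
Proof. by rewrite ffunE. Qed.
Lemma underM (g h : W) : under (g * h)%g = (under g * under h)%g.
Proof. by []. Qed.
Lemma color1 i : color (1%g : W) i = 0%R. Proof. by rewrite ffunE. Qed.
Lemma under1 : under (1%g : W) = 1%g. Proof. by []. Qed.

Definition one_line (g : W) (i : 'I_n.+1) : colored d n := (color g i, under g i).

(* s_ i exchanges positions i and i.+1; only i < n is meaningful *)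
Definition s_ (i : nat) : W := Wreath [ffun=> 0%R] (tperm (inord i) (inord i.+1)).
(* inZp 1 is the exponent of zeta in 'I_d.+1, which is 0 when d.+1 = 1 *)
Definition t_0 : W := Wreath [ffun i => if i == ord0 then inZp 1 else 0%R] 1%g.
(* s_(i-1) ... s_0 t_0 s_0 ... s_(i-1) *)
Fixpoint t_ (i : nat) : W :=
  if i is j.+1 then (s_ j * t_ j * s_ j)%g else t_0.

(* Left multiplication by s_i and t acts on one-line notations as prescribed, *)
(* s_i and t generate, and one_line is injective (its image consists of all   *)
(* colored permutations by construction).                                     *)
Lemma one_line_s i g (j : 'I_n.+1) :
  one_line (s_ i * g)%g j = one_line g (tperm (inord i) (inord i.+1) j).
Proof. by rewrite /one_line colorM underM permM ffunE add0r. Qed.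

Lemma one_line_t g (j : 'I_n.+1) :
  one_line (t_0 * g)%g j =
  if j == ord0 then ((inZp 1 + color g j)%R, under g j) else one_line g j.
Proof.
by rewrite /one_line colorM underM permM perm1 ffunE; case: eqP; rewrite ?add0r.
Qed.

Lemma wreath_gen : <<t_0 |: [set s_ i | i : 'I_n]>>%g = [set: W].
Proof.
set H := <<_>>%g; have Ht : t_0 \in H by rewrite mem_gen ?setU11.
have Hs i : i < n -> s_ i \in H.
  move=> lt_in; rewrite mem_gen // inE; apply/orP; right.
  by apply/imsetP; exists (Ordinal lt_in).
pose lift (w : 'S_n.+1) : W := Wreath [ffun=> 0%R] w.
have liftM v w : lift (v * w)%g = (lift v * lift w)%g.
  by apply: wreath_eq => [i|] //; rewrite colorM !ffunE add0r.
have Htp m : m <= n -> lift (tperm ord0 (inord m)) \in H.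
  elim: m => [|m IHm] lt_mn.
    suff -> : inord 0 = ord0 :> 'I_n.+1 by rewrite tperm1; apply: group1.
    by apply/val_inj; rewrite /= inordK.
  have [m0|m_gt0] := posnP m.
    suff <- : inord m = ord0 :> 'I_n.+1 by apply: Hs.
    by apply/val_inj; rewrite /= inordK m0.
  suff -> : lift (tperm ord0 (inord m.+1)) =
      (s_ m * lift (tperm ord0 (inord m)) * s_ m)%g.
    by apply: groupM; [apply: groupM; [exact: Hs | exact: IHm (ltnW lt_mn)] | exact: Hs].
  rewrite -/(lift (tperm (inord m) (inord m.+1))) -!liftM; congr lift.
  rewrite -[X in (X * _ * _)%g]tpermV -mulgA -conjgE tpermJ tpermL tpermD //.
    by rewrite -val_eqE /= inordK ?ltnS ?(ltnW lt_mn) // -lt0n.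
  by rewrite -val_eqE /= inordK.
have Hl w : lift w \in H.
  have gP : group_set [set w | lift w \in H].
    apply/group_setP; split=> [|v w' ]; rewrite !inE ?group1 // => Hv Hw.
    by rewrite liftM groupM.
  suff : w \in Group gP by rewrite inE.
  have : w \in [set: {perm 'I_n.+1}] by rewrite inE.
  rewrite -(gen_tperm ord0); apply: subsetP.
  rewrite gen_subG; apply/subsetP => _ /imsetP[j _ ->].
  by rewrite inE -[j]inord_val Htp // -ltnS.
pose bc (c : {ffun 'I_n.+1 -> 'I_d.+1}) : W := Wreath c 1%g.
have bcD (c c' : {ffun 'I_n.+1 -> 'I_d.+1}) : bc (c + c')%R = (bc c * bc c')%g.
  by apply: wreath_eq => [i|] /=; rewrite ?mulg1 // !ffunE perm1.
pose e (i : 'I_n.+1) : {ffun 'I_n.+1 -> 'I_d.+1} :=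
  [ffun j => if j == i then inZp 1 else 0%R].
have He i : bc (e i) \in H.
  suff -> : bc (e i) = (lift (tperm ord0 i) * t_0 * lift (tperm ord0 i))%g.
    by rewrite !groupM.
  apply: wreath_eq => [j|]; last by rewrite !underM mulg1 tperm2.
  rewrite !colorM !ffunE add0r addr0 /=; congr (if _ then _ else _).
  by rewrite (can2_eq (tpermK _ _) (tpermK _ _)) tpermL.
have Hb c : bc c \in H.
  have -> : c = (\sum_i e i *+ c i)%R.
    apply/ffunP => j; rewrite sum_ffunE (bigD1 j) //= big1 => [|i ij].
      rewrite [RHS]addr0 ffunMnE ffunE eqxx Zp_mulrn.
      by apply/val_inj; rewrite /= modnMml mul1n modn_small.
    by rewrite ffunMnE ffunE eq_sym (negPf ij) mul0rn.
  have H0 : bc 0%R \in H.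
    suff -> : bc 0%R = 1%g by rewrite group1.
    by apply: wreath_eq => // i; rewrite !ffunE.
  elim/big_ind: _ => [//|c1 c2 Hc1 Hc2|i _]; first by rewrite bcD groupM.
  by elim: (c i : nat) => [|m IHm]; rewrite ?mulr0n // mulrS bcD groupM.
apply/setP => g; rewrite !inE; suff -> : g = (bc (color g) * lift (under g))%g.
  by rewrite groupM.
by apply: wreath_eq => [i|]; rewrite ?underM ?mul1g // colorM !ffunE addr0.
Qed.

Lemma one_line_inj (g h : W) : one_line g =1 one_line h -> g = h.
Proof.
move=> gh; apply: wreath_eq => [i|]; first by have [] := gh i.
by apply/permP => i; have [] := gh i.
Qed.

(* G([a+1, a+l]), for l > 0 *)
Definition interval_group (a l : nat) : {group W} :=
  <<t_ a |: [set s_ (a + i) | i : 'I_l.-1]>>%G.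

End WreathGroup.

(** d-partitions *)

Definition is_partition (s : seq nat) := sorted geq s && all (ltn 0) s.

Record dpartition (d n : nat) : Type := DPartition {
  dpart :> 'I_d.+1 -> seq nat;
  dpart_part : forall k, is_partition (dpart k);
  dpart_sum : \sum_(k < d.+1) sumn (dpart k) = n.+1 }.

(** Young subgroups of the wreath product *)

Section Young.
Variables (d n : nat) (lam : dpartition d n).
Local Notation W := (wreath d n).

(* number of letters before the interval K^k_i; i counts from 0 *)
Definition Kstart (k : 'I_d.+1) (i : nat) : nat :=
  \sum_(l < d.+1 | l < k) sumn (lam l) + sumn (take i (lam k)).

Definition G_K (k : 'I_d.+1) (i : 'I_(size (lam k))) : {group W} :=
  interval_group d n (Kstart k i) (nth 0 (lam k) i).
Definition G_lam_k (k : 'I_d.+1) : {group W} := (\prod_(i < size (lam k)) G_K i)%G.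
Definition G_lam : {group W} := (\prod_k G_lam_k k)%G.

(* The rest of this section shows that these products of groups, which are    *)
(* joins for (\prod_ _ _)%G, are internal direct products.                    *)

Definition moves_in (S : {set 'I_n.+1}) : {set W} :=
  [set g | [forall i, (i \in S) || (color g i == 0%R) && (under g i == i)]].

Lemma moves_inP (S : {set 'I_n.+1}) (g : W) : reflect
  (forall i, i \notin S -> color g i = 0%R /\ under g i = i) (g \in moves_in S).
Proof.
rewrite inE; apply: (iffP forallP) => gS i.
  by move=> /negPf iS; have := gS i; rewrite iS => /andP[/eqP -> /eqP ->].
by have [//|/gS [-> ->]] := boolP (i \in S); rewrite !eqxx.
Qed.

Lemma moves_in_group (S : {set 'I_n.+1}) : group_set (moves_in S).
Proof.
apply/group_setP; split; first by apply/moves_inP => i _; rewrite color1 perm1.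
move=> g h /moves_inP gS /moves_inP hS; apply/moves_inP => i iS.
by rewrite colorM underM permM; have [-> ->] := gS i iS; have [-> ->] := hS i iS; rewrite addr0.
Qed.
Canonical moves_in_Group S := Group (moves_in_group S).

Lemma moves_inS (S T : {set 'I_n.+1}) : S \subset T -> moves_in S \subset moves_in T.
Proof.
move=> /subsetP sST; apply/subsetP=> g /moves_inP gS; apply/moves_inP=> i iT.
by apply: gS; apply: contra iT; apply: sST.
Qed.

Lemma moves_in_stable (S : {set 'I_n.+1}) (g : W) i : g \in moves_in S -> i \in S -> under g i \in S.
Proof.
move=> /moves_inP gS iS; apply: contraLR iS => /[dup] giS /gS [_ /perm_inj gi].
by rewrite -gi.
Qed.

Lemma moves_in_cent (S T : {set 'I_n.+1}) :
  [disjoint S & T] -> moves_in S \subset ('C(moves_in T) :\: (moves_in T)^#)%g.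
Proof.
move=> dST; have sC (A B : {set 'I_n.+1}) i : [disjoint A & B] -> i \in A -> i \notin B.
  by move=> dAB iA; rewrite (disjointFr dAB).
have dTS : [disjoint T & S] by rewrite disjoint_sym.
rewrite subsetD; apply/andP; split.
  apply/centsP => g gS h hT; apply: wreath_eq => [i|] /=.
    rewrite !colorM; have [iS|iS] := boolP (i \in S).
      have [-> ->] := moves_inP _ _ hT i (sC _ _ _ dST iS).
      have [-> _] := moves_inP _ _ hT _ (sC _ _ _ dST (moves_in_stable gS iS)).
      by rewrite addrC.
    have [-> ->] := moves_inP _ _ gS i iS.
    have [iT|iT] := boolP (i \in T).
      have [-> _] := moves_inP _ _ gS _ (sC _ _ _ dTS (moves_in_stable hT iT)).
      by rewrite addrC.
    have [-> ->] := moves_inP _ _ hT i iT.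
    by have [-> _] := moves_inP _ _ gS i iS.
  apply/permP => i; rewrite !permM; have [iS|iS] := boolP (i \in S).
    have [_ ->] := moves_inP _ _ hT i (sC _ _ _ dST iS).
    by have [_ ->] := moves_inP _ _ hT _ (sC _ _ _ dST (moves_in_stable gS iS)).
  have [_ ->] := moves_inP _ _ gS i iS.
  have [iT|iT] := boolP (i \in T).
    by have [_ ->] := moves_inP _ _ gS _ (sC _ _ _ dTS (moves_in_stable hT iT)).
  have [_ ->] := moves_inP _ _ hT i iT.
  by have [_ ->] := moves_inP _ _ gS i iS.
rewrite disjoint_subset; apply/subsetP => g gS.
apply/negP => /setD1P[/negP gN1 gT]; apply: gN1.
suff all0 i : color g i = 0%R /\ under g i = i.
  apply/eqP; apply: wreath_eq => [i|]; first by rewrite color1; case: (all0 i).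
  by apply/permP => i; rewrite perm1; case: (all0 i).
have [iS|iS] := boolP (i \in S); last exact: moves_inP gS i iS.
exact: moves_inP gT i (sC _ _ _ dST iS).
Qed.

Lemma dprod_moves (I : finType) (H : I -> {group W}) (S : I -> {set 'I_n.+1}) :
    (forall i, H i \subset moves_in (S i)) ->
    (forall i j, i != j -> [disjoint S i & S j]) ->
  \big[dprod/1%g]_i H i = (\prod_i H i)%G.
Proof.
move=> HS dS; apply/eqP/bigdprodYP => i _.
have sub : (\prod_(j | j != i) H j)%G \subset moves_in (~: S i).
  rewrite bigprodGE gen_subG; apply/bigcupsP => j ji.
  by apply: subset_trans (HS j) _; apply: moves_inS; rewrite -disjoints_subset dS.
apply: subset_trans sub _; apply: subset_trans (moves_in_cent (T := S i) _) _.
  by rewrite disjoints_subset.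
by apply: setDSS; [apply: centS | apply: setSD].
Qed.

Definition interval (a l : nat) : {set 'I_n.+1} := [set i : 'I_n.+1 | a <= i < a + l].

Lemma s_moves i : i < n -> s_ d n i \in moves_in (interval i 2).
Proof.
move=> lt_in; apply/moves_inP => j; rewrite inE negb_and -leqNgt addn2 /= ffunE => ji.
have iS : (inord i : 'I_n.+1) = i :> nat by rewrite inordK // ltnS ltnW.
have iS1 : (inord i.+1 : 'I_n.+1) = i.+1 :> nat by rewrite inordK // ltnS.
split=> //; apply: tpermD; apply: contraTneq ji => <-.
  by rewrite iS leqnn /= -ltnNge ltnS leqnSn.
by rewrite iS1 leqnSn /= -ltnNge ltnS.
Qed.

Lemma t_moves a : a <= n -> t_ d n a \in moves_in (interval a 1).
Proof.
elim: a => [_|a IHa lt_an].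
  apply/moves_inP => j; rewrite inE leq0n add0n ltnS leqn0 /= => /negPf jN0.
  by rewrite /= ffunE perm1 -val_eqE /= jN0.
have /moves_inP tP := IHa (ltnW lt_an).
have aS : (inord a : 'I_n.+1) = a :> nat by rewrite inordK // ltnS ltnW.
have aS1 : (inord a.+1 : 'I_n.+1) = a.+1 :> nat by rewrite inordK // ltnS.
apply/moves_inP => j; rewrite inE addn1 ltnS -eqn_leq => ja.
rewrite !colorM !underM !permM !ffunE /= add0r addr0.
have jN : inord a.+1 != j by apply: contra ja => /eqP <-; rewrite aS1.
have nI : tperm (inord a) (inord a.+1) j \notin interval a 1.
  rewrite inE addn1 ltnS -eqn_leq.
  have [-> |jNa] := eqVneq j (inord a); first by rewrite tpermL aS1 neq_ltn ltnSn.
  rewrite tpermD 1?eq_sym //; last by rewrite eq_sym.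
  by apply: contra jNa => /eqP e; apply/eqP/val_inj; rewrite /= aS.
by have [-> ->] := tP _ nI; rewrite tpermK.
Qed.

Lemma interval_moves a l : 0 < l -> a + l <= n.+1 ->
  interval_group d n a l \subset moves_in (interval a l).
Proof.
case: l => // l _; rewrite addnS ltnS => al.
rewrite gen_subG subUset sub1set; apply/andP; split.
  apply: subsetP (t_moves (leq_trans (leq_addr _ _) al)).
  apply: moves_inS; apply/subsetP => i; rewrite !inE => /andP[-> /leq_trans]; apply.
  by rewrite leq_add2l.
apply/subsetP => _ /imsetP[i _ ->].
have lt_i : a + i < a + l by rewrite ltn_add2l.
apply: subsetP (s_moves (leq_trans lt_i al)).
apply: moves_inS; apply/subsetP => j; rewrite !inE => /andP[le_ij lt_j].
rewrite (leq_trans (leq_addr _ _) le_ij) (leq_trans lt_j) //.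
by rewrite addn2 addnS ltnS.
Qed.

Lemma sumn_take s i j : i <= j -> sumn (take i s) <= sumn (take j s).
Proof.
elim: s i j => [|x s IHs] [|i] [|j] //= ij.
by rewrite leq_add2l IHs.
Qed.

Lemma sumn_takeS s i : i < size s -> sumn (take i.+1 s) = sumn (take i s) + nth 0 s i.
Proof. by move=> lt_i; rewrite (take_nth 0) // sumn_rcons. Qed.

Lemma Kend k (i : 'I_(size (lam k))) :
  Kstart k i + nth 0 (lam k) i = Kstart k i.+1.
Proof. by rewrite /Kstart -addnA sumn_takeS. Qed.

Lemma Kstart_le k i : Kstart k i <= Kstart k (size (lam k)).
Proof.
rewrite leq_add2l take_size; have [le_i|/ltnW lt_i] := leqP (size (lam k)) i.
  by rewrite take_oversize.
by rewrite -{2}[lam k]take_size sumn_take.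
Qed.

Lemma Kstart_next (k l : 'I_d.+1) i : k < l -> Kstart k (size (lam k)) <= Kstart l i.
Proof.
move=> lt_kl; apply: leq_trans (leq_addr _ _).
rewrite /Kstart take_size (bigD1 (P := fun j : 'I__ => j < l) k) //= addnC leq_add2l.
rewrite [X in _ <= X](bigID (fun j : 'I__ => j < k)) /=.
apply: leq_trans (leq_addr _ _); apply: eq_leq; apply: eq_bigl => j.
have [lt_jk|] := ltnP j k; rewrite ?andbF // (ltn_trans lt_jk lt_kl) /= andbT.
by rewrite -val_eqE /= ltn_eqF.
Qed.

Lemma Kstart_max k : Kstart k (size (lam k)) <= n.+1.
Proof.
rewrite -(dpart_sum lam) /Kstart take_size [X in _ <= X](bigD1 k) //= addnC leq_add2l.
rewrite [X in _ <= X](bigID (fun j : 'I__ => j < k)) /=.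
apply: leq_trans (leq_addr _ _); apply: eq_leq; apply: eq_bigl => j.
by have [lt_jk|] := ltnP j k; rewrite ?andbF // andbT -val_eqE /= ltn_eqF.
Qed.

Definition K_ k (i : 'I_(size (lam k))) := interval (Kstart k i) (nth 0 (lam k) i).
Definition J_ k :=
  interval (Kstart k 0) (sumn (lam k)).

Lemma K_J k i : K_ (k := k) i \subset J_ k.
Proof.
apply/subsetP => j; rewrite !inE Kend => /andP[le_j lt_j].
rewrite (leq_trans _ le_j) ?leq_add2l ?sumn_take // (leq_trans lt_j) //=.
by apply: leq_trans (Kstart_le _ _) _; rewrite /Kstart take_size take0 addn0.
Qed.

Lemma disjoint_interval a l b m : a + l <= b -> [disjoint interval a l & interval b m].
Proof.
move=> le_b; rewrite disjoint_subset; apply/subsetP => j; rewrite !inE => /andP[_ lt_j].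
by rewrite negb_and -ltnNge (leq_trans lt_j).
Qed.

Lemma K_disjoint k (i j : 'I_(size (lam k))) : i != j -> [disjoint K_ i & K_ j].
Proof.
rewrite -val_eqE /= neq_ltn => /orP[] lt_ij; last rewrite disjoint_sym.
  by apply: disjoint_interval; rewrite Kend leq_add2l sumn_take.
by apply: disjoint_interval; rewrite Kend leq_add2l sumn_take.
Qed.

Lemma J_disjoint k l : k != l -> [disjoint J_ k & J_ l].
Proof.
rewrite -val_eqE /= neq_ltn => /orP[] lt_kl; last rewrite disjoint_sym.
  apply: disjoint_interval; apply: leq_trans (Kstart_next _ lt_kl).
  by rewrite /Kstart take_size take0 addn0.
apply: disjoint_interval; apply: leq_trans (Kstart_next _ lt_kl).
by rewrite /Kstart take_size take0 addn0.
Qed.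

Lemma G_K_moves k (i : 'I_(size (lam k))) : G_K i \subset moves_in (K_ i).
Proof.
apply: interval_moves; last by rewrite Kend (leq_trans (Kstart_le _ _)) ?Kstart_max.
by have /andP[_ /all_nthP] := dpart_part lam k; apply.
Qed.

Lemma G_lam_k_dprod k : \big[dprod/1%g]_(i < size (lam k)) G_K i = G_lam_k k.
Proof. exact: (dprod_moves (@G_K_moves k) (@K_disjoint k)). Qed.

Lemma G_lam_k_moves k : G_lam_k k \subset moves_in (J_ k).
Proof.
rewrite /G_lam_k bigprodGE gen_subG; apply/bigcupsP => i _.
exact: subset_trans (G_K_moves i) (moves_inS (K_J i)).
Qed.

Lemma G_lam_dprod : \big[dprod/1%g]_k G_lam_k k = G_lam.
Proof. exact: (dprod_moves G_lam_k_moves J_disjoint). Qed.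

End Young.

(** Characters *)

(* beta_k ranges over the trivial character 1 and the sign character epsilon *)
Variant one_dim := Triv | Sgn.

Definition one_dim_val (b : one_dim) (T : finType) (w : {perm T}) : algC :=
  if b is Sgn then ((-1) ^+ odd_perm w)%R else 1%R.

Lemma one_dim_valM b T (v w : {perm T}) :
  one_dim_val b (v * w)%g = (one_dim_val b v * one_dim_val b w)%R.
Proof. by case: b; rewrite /= ?mulr1 // odd_permM signr_addb. Qed.

Section SymmetricCharacters.
Variables (m : nat) (s : seq nat) (b : one_dim).

Fact sym_char_subproof : is_class_fun <<[set: 'S_m]>>%g [ffun w => one_dim_val b w].
Proof.
rewrite genGid; apply: intro_class_fun => [v w _ _|v]; last by rewrite inE.
by case: b; rewrite //= odd_permJ.
Qed.
Definition sym_char : 'CF([set: 'S_m]) := Cfun 0 sym_char_subproof.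

(* consecutive intervals of lengths s_0, s_1, ... *)
Definition young_block (i : nat) : {set 'I_m} :=
  [set j : 'I_m | sumn (take i s) <= j < sumn (take i.+1 s)].
(* the permutations that stabilize every block *)
Definition young_group : {group 'S_m} :=
  (\bigcap_(i < size s) 'N(young_block i | 'P))%G.

(* beta restricted to S_s and induced to S_m, for s a partition of m *)
Definition sym_monomial_char : 'CF([set: 'S_m]) :=
  ('Ind[[set: 'S_m], young_group] ('Res[young_group] sym_char))%R.

End SymmetricCharacters.

Section WreathCharacters.
Variables (d n : nat) (zeta : algC).
Hypothesis zetaP : (d.+1.-primitive_root zeta)%R.
Local Notation W := (wreath d n).

Definition color_sum (g : W) : 'I_d.+1 := (\sum_i color g i)%R.

Lemma color_sumM g h : color_sum (g * h)%g = (color_sum g + color_sum h)%R.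
Proof.
rewrite /color_sum (eq_bigr _ (fun i _ => colorM g h i)) big_split /=.
by rewrite -[X in (_ + X)%R = _](reindex_inj (@perm_inj _ (under g)) (P := xpredT)).
Qed.
Lemma color_sum1 : color_sum 1%g = 0%R.
Proof. by rewrite /color_sum big1 // => i _; rewrite color1. Qed.

Section Delta.
Variables (k : 'I_d.+1) (b : one_dim).

(* delta_k beta: g |-> zeta^(k * sum of the colors of g) * beta (under g) *)
Definition delta_val (g : W) : algC :=
  (zeta ^+ (k * color_sum g) * one_dim_val b (under g))%R.

Lemma delta_valM g h : delta_val (g * h)%g = (delta_val g * delta_val h)%R.
Proof.
rewrite /delta_val underM one_dim_valM mulrACA -exprD -mulnDr; congr (_ * _)%R.
have -> : color_sum (g * h)%g = (color_sum g + color_sum h) %% d.+1 :> nat.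
  by rewrite color_sumM.
by rewrite mulnC [in RHS]mulnC !exprM (prim_expr_mod zetaP).
Qed.

Lemma delta_val1 : delta_val 1%g = 1%R.
Proof.
by rewrite /delta_val color_sum1 muln0 mul1r; case: b; rewrite /= ?odd_perm1.
Qed.

Fact delta_subproof : is_class_fun <<[set: W]>>%g [ffun g => delta_val g].
Proof.
rewrite genGid; apply: intro_class_fun => [g h _ _|g]; last by rewrite inE.
by rewrite conjgE !delta_valM mulrCA -delta_valM mulVg delta_val1 mulr1.
Qed.
Definition delta_char : 'CF([set: W]) := Cfun 0 delta_subproof.

Lemma delta_char_lin : delta_char \is a linear_char.
Proof.
suff : delta_char \is a character by move=> chi; rewrite qualifE /= chi cfunE delta_val1 /=.
pose rho (g : W) : 'M[algC]_1 := ((delta_val g)%:M)%R.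
have rhoP : mx_repr [set: W] rho.
  split=> [|g h _ _]; first by rewrite /rho delta_val1.
  by rewrite /rho delta_valM scalar_mxM.
apply/char_reprP; exists (Representation (MxRepresentation rhoP)).
apply/cfunP => g; rewrite !cfunE /= inE mulr1n /rho.
by rewrite /mxtrace big_ord1 mxE eqxx.
Qed.

Lemma delta_char_s i : i < n ->
  delta_char (s_ d n i) = if b is Sgn then (-1)%R else 1%R.
Proof.
move=> lt_in; rewrite cfunE /delta_val /color_sum big1 => [|j _]; last by rewrite ffunE.
rewrite muln0 mul1r; case: b => //=; rewrite odd_tperm.
suff -> : inord i != inord i.+1 :> 'I_n.+1 by [].
by rewrite -val_eqE /= !inordK ?ltnS ?(ltnW lt_in) // neq_ltn ltnSn.
Qed.

Lemma delta_char_t : delta_char (t_0 d n) = (zeta ^+ k)%R.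
Proof.
have sum_t : color_sum (t_0 d n) = inZp 1.
  rewrite /color_sum (bigD1 ord0) // big1 => [|j jN0]; last first.
    by rewrite ffunE (negPf jN0).
  by rewrite [LHS]addr0 ffunE eqxx.
rewrite cfunE /delta_val sum_t [X in (_ * X)%R](_ : _ = 1%R); last first.
  by case: b; rewrite /= ?odd_perm1.
by rewrite mulr1 mulnC exprM (prim_expr_mod zetaP) expr1.
Qed.

End Delta.

Variables (lam : dpartition d n) (beta : 'I_d.+1 -> one_dim).

(* delta_0 beta_0 (x) ... (x) delta_d beta_d *)
Definition tensor_char : 'CF(G_lam lam) :=
  cfBigdprod (G_lam_dprod lam)
    (fun k => 'Res[G_lam_k lam k] (delta_char k (beta k)))%R.

Lemma tensor_charE (y : 'I_d.+1 -> W) :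
    (forall k, y k \in G_lam_k lam k) ->
  tensor_char (\prod_k y k)%g = (\prod_k delta_char k (beta k) (y k))%R.
Proof.
move=> Gy; rewrite cfBigdprodE; last by move=> k _; apply: Gy.
by apply: eq_bigr => k _; rewrite cfResE ?subsetT.
Qed.

Definition wreath_monomial_char : 'CF([set: W]) :=
  ('Ind[[set: W], G_lam lam] tensor_char)%R.

End WreathCharacters.

Section Immanants.
Local Open Scope ring_scope.

Definition Imm (A : comAlgType algC) (m : nat) (theta : 'S_m -> algC)
    (z : 'M[A]_m) : A :=
  \sum_(w : 'S_m) theta w *: \prod_(i < m) z i (w i).

Definition wreath_Imm (A : comAlgType algC) (d n : nat)
    (theta : wreath d n -> algC) (x : 'I_n.+1 -> colored d n -> A) : A :=
  \sum_(g : wreath d n) theta g^-1%g *: \prod_(i < n.+1) x i (one_line g i).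

Definition Qmx (A : comAlgType algC) (d n : nat) (zeta : algC)
    (x : 'I_n.+1 -> colored d n -> A) (k : 'I_d.+1) : 'M[A]_n.+1 :=
  \matrix_(i, j) \sum_(c < d.+1) zeta ^- (c * k) *: x i (c, j).

(* enum_val enumerates I in increasing order *)
Definition principal_submx (A : Type) (m : nat) (Z : 'M[A]_m) (I : {set 'I_m}) :
  'M[A]_#|I| := mxsub (@enum_val _ (mem I)) (@enum_val _ (mem I)) Z.

Definition ordered_set_partition (d n : nat) (a : 'I_d.+1 -> nat)
    (I : {ffun 'I_d.+1 -> {set 'I_n.+1}}) : bool :=
  [forall k, #|I k| == a k]
  && [forall k, forall l, (k != l) ==> [disjoint I k & I l]].

(* C[x]: one indeterminate x_(i, j) for each i in [n] and j in C_d[n] *)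
Notation var_index d n := ('I_n.+1 * colored d n)%type.
Notation wreath_poly d n := {mpoly algC[#|{: var_index d n}|]}.
Definition xvar (d n : nat) (i : 'I_n.+1) (j : colored d n) : wreath_poly d n :=
  'X_(enum_rank ((i, j) : var_index d n)).

End Immanants.

(* Main.v *)
Require Import Defs.
From mathcomp Require Import all_boot all_order all_algebra all_fingroup.
From mathcomp Require Import all_solvable all_field all_character.
From mathcomp Require Import mpoly.

Set Implicit Arguments.
Unset Strict Implicit.
Unset Printing Implicit Defensive.

Import GRing.Theory Num.Theory.
Local Open Scope ring_scope.

(** Both sides are equal to one sum over pairs (f, w).  Here f labels every
    position i with a pair (k, l), the name of the l-th part of lambda^k;
    it has the type of lambda when the label (k, l) is used lambda^k_l times.
    The permutation w must satisfy f o w = f.  Let kappa be the first component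
    of f.  The pair (f, w) contributes
      prod_k beta_k(w restricted to kappa^-1(k)) * prod_i Q_{kappa i}(i, w i).

    The reason is that labellings of a given type are the cosets of a Young
    subgroup.  A symmetric group acts transitively on them by relabelling
    (relabel_transitive), and the stabilizer of the standard labelling is the
    Young subgroup.  The induced character is a sum over conjugators; as the
    summand depends only on the labelling which the conjugator produces, and
    each labelling is produced as often as the stabilizer has elements, the
    sum is one over labellings and the normalizing factor 1/|H| disappears
    (sum_relabel).

    On the left, G(lambda) is the set of all g whose underlying permutation
    fixes the standard labelling (mem_G_lam), so the same argument applies to
    the wreath product, the colors of the conjugator contributing the number
    of colorings as a common factor of |H| and of the sum.  Conjugation does not change the product
    of the color characters on a block, because the colors of the conjugator
    cancel along w.  Hence the character at g^-1 is a sum over labellings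
    fixed by w of prod_i zeta^(- kappa(i) c_i) times signs
    (wreath_monomial_charV), and summing over the colors c_i independently at
    each position i produces the entries of the matrices Q_k
    (wreath_Imm_labelled).

    On the right, each ordinary immanant is a sum over permutations supported
    in I_k and labellings of I_k (Imm_principal_submx).  A product over k of
    such sums is a sum over global permutations and labellings respecting the
    set partition (prod_sum_perm_on, prod_sum_support), and the partition
    itself is the function kappa (sum_ordered_set_partition); this is
    sum_prod_Imm. *)

(** * Labellings and their symmetries *)

Section Labellings.
Variables (T L : finType).
Implicit Types (f : {ffun T -> L}) (v w : {perm T}).

Definition fiber (f : T -> L) (l : L) : {set T} := [set i | f i == l].

(** Disjointness and the count together force the sets to cover T, so every
    point lies in exactly one of them. *)
Lemma labelling_of_disjoint (S : L -> {set T}) :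
    (forall l l', l != l' -> [disjoint S l & S l']) ->
    (\sum_l #|S l|)%N = #|T| ->
  exists f : {ffun T -> L}, forall l, fiber f l = S l.
Proof.
move=> dS cS; have card_cup : (\sum_l #|S l|)%N = #|\bigcup_l S l|.
  rewrite -sum1_card partition_disjoint_bigcup //=.
  by apply: eq_bigr => l _; rewrite sum1_card.
have cov i : exists l, i \in S l.
  have : \bigcup_l S l = [set: T].
    by apply/eqP; rewrite eqEcard subsetT -card_cup cS cardsT leqnn.
  by move/setP/(_ i); rewrite inE => /bigcupP[l _ il]; exists l.
have [f fS] := fin_all_exists cov; exists (finfun f) => l.
apply/setP => i; rewrite inE ffunE; apply/eqP/idP => [<- // | il].
by apply: contraTeq (fS i) => /dS /disjointFl ->.
Qed.

Definition relabel (f : {ffun T -> L}) (v : {perm T}) : {ffun T -> L} :=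
  [ffun i => f (v i)].

Lemma relabel_fixP f v : reflect (forall i, f (v i) = f i) (relabel f v == f).
Proof.
by apply: (iffP eqP) => [/ffunP fv i | fv]; [have := fv i | apply/ffunP => i];
  rewrite ffunE.
Qed.

Lemma relabelM f v w : relabel f (v * w)%g = relabel (relabel f w) v.
Proof. by apply/ffunP => i; rewrite !ffunE permM. Qed.

Lemma relabel1 f : relabel f 1%g = f.
Proof. by apply/ffunP => i; rewrite ffunE perm1. Qed.

Lemma card_fiber_relabel f v l : #|fiber (relabel f v) l| = #|fiber f l|.
Proof.
rewrite -(card_preimset (fiber f l) (@perm_inj _ v)); congr #|pred_of_set _|.
by apply/setP => i; rewrite !inE ffunE.
Qed.

End Labellings.

Section Orbit.
Variables (m : nat) (L : finType).
Implicit Types f : {ffun 'I_m -> L}.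

(** Two words with the same letter counts are rearrangements of each other. *)
Lemma relabel_transitive f f' :
  (forall l, #|fiber f' l| = #|fiber f l|) -> exists v, relabel f v = f'.
Proof.
move=> ff'; pose t (g : {ffun 'I_m -> L}) := [tuple g i | i < m].
have cnt (g : {ffun 'I_m -> L}) l : count_mem l (t g) = #|fiber g l|.
  rewrite /= count_map cardE /enum_mem size_filter count_filter.
  by apply: eq_count => i /=; rewrite !inE andbT.
have /tuple_permP[v /val_inj def_f'] : perm_eq (t f') (t f).
  by apply/allP => l _; rewrite /= -/(t f') -/(t f) !cnt ff'.
exists v; apply/ffunP => i; rewrite ffunE.
by have /(congr1 (fun s => tnth s i)) := def_f'; rewrite !tnth_mktuple.
Qed.

(** Orbit-stabilizer for labellings: the permutations producing a given f'
    form a coset of the stabilizer of f, and the orbit of f consists of the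
    labellings with the same fiber sizes. *)
Lemma sum_relabel (V : nmodType) (F : {ffun 'I_m -> L} -> V) f :
  \sum_(v : 'S_m) F (relabel f v) =
  (\sum_(f' : {ffun 'I_m -> L} | [forall l, #|fiber f' l| == #|fiber f l|]) F f')
     *+ #|[set v : 'S_m | relabel f v == f]|.
Proof.
rewrite (partition_big (relabel f)
  (fun f' : {ffun 'I_m -> L} => [forall l, #|fiber f' l| == #|fiber f l|])); last first.
  by move=> v _; apply/forallP => l; rewrite card_fiber_relabel.
rewrite -sumrMnl; apply: eq_bigr => f' /forallP ff'.
have [v0 <- {f' ff'}] := relabel_transitive (fun l => eqP (ff' l)).
rewrite (eq_bigr (fun=> F (relabel f v0))) => [|v /= /eqP -> //].
rewrite sumr_const; congr (_ *+ _).
rewrite -[RHS](card_imset _ (mulgI v0)); apply: eq_card => v.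
(* v0 times the stabilizer of f: relabel is a contravariant action. *)
rewrite -[LHS]/(relabel f v == relabel f v0); apply/eqP/imsetP => [fv | [s]].
  exists (v0^-1 * v)%g; last by rewrite mulKVg.
  by rewrite inE relabelM fv -relabelM mulVg relabel1.
by rewrite inE => /eqP fs ->; rewrite relabelM fs.
Qed.

End Orbit.

(** * Gluing local permutations and labellings *)

Section Distribution.
Variables (T D : finType) (kappa : {ffun T -> D}) (A : comPzSemiRingType).
Implicit Types (w : {perm T}) (k : D).

Lemma fiber_stable w k : relabel kappa w == kappa -> w \in 'N(fiber kappa k | 'P)%g.
Proof.
by move=> /relabel_fixP kw; apply/astabsP => i; rewrite /= apermE !inE kw.
Qed.

Lemma restr_fiberE w k i : relabel kappa w == kappa ->
  restr_perm (fiber kappa k) w i = if kappa i == k then w i else i.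
Proof.
move=> kw; case: ifPn => ik; first by rewrite restr_permE ?fiber_stable ?inE.
by rewrite (out_perm (restr_perm_on _ _)) // inE.
Qed.

(** A permutation preserving every fiber of kappa is the same as an independent
    choice of a permutation of each fiber: glue the family by letting the k-th
    member act on the k-th fiber, and recover it by restriction. *)
Lemma prod_sum_perm_on (F : D -> {perm T} -> A) :
  \prod_k \sum_(w | perm_on (fiber kappa k) w) F k w =
  \sum_(w | relabel kappa w == kappa) \prod_k F k (restr_perm (fiber kappa k) w).
Proof.
rewrite bigA_distr_big_dep.
pose split w : {ffun D -> {perm T}} := [ffun k => restr_perm (fiber kappa k) w].
(* A family that permutes each fiber has a gluing, so the default 1 is not
   reached for it. *)
pose glue (g : {ffun D -> {perm T}}) :=
  odflt 1%g [pick w : {perm T} | [forall i, w i == g (kappa i) i]].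
rewrite (reindex_onto split glue) => [|g /familyP gP]; last first.
  have g_in k i : kappa (g k i) == k = (kappa i == k).
    by have := perm_closed i (gP k); rewrite !inE.
  have g_inj : injective (fun i => g (kappa i) i).
    (* The common value lies in the fibers of both i and j. *)
    move=> i j /= gij; have kij : kappa i = kappa j.
      have := g_in (kappa i) i; rewrite eqxx gij => /eqP <-.
      by apply/eqP; rewrite g_in.
    by move: gij; rewrite kij => /perm_inj.
  have kg : relabel kappa (perm g_inj) == kappa.
    by apply/relabel_fixP => i; apply/eqP; rewrite permE g_in.
  rewrite /glue; case: pickP => [w /forallP wg | /(_ (perm g_inj))]; last first.
    by move/forallP; case=> i; rewrite permE.
  have -> : w = perm g_inj by apply/permP => i; rewrite permE; apply/eqP.
  apply/ffunP => k; apply/permP => i; rewrite ffunE restr_fiberE // permE.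
  by case: eqP => [-> // | /eqP ik]; rewrite (out_perm (gP k)) // inE.
apply: eq_big => [w | w _]; last by apply: eq_bigr => k _; rewrite ffunE.
apply/andP/idP => [[_ /eqP <-] | kw]; last split.
- rewrite /glue; case: pickP => [v /forallP vP | _]; last by rewrite /= relabel1.
  apply/relabel_fixP => i /=; have := vP i; rewrite ffunE => /eqP ->.
  apply/eqP; have := perm_closed i (restr_perm_on (fiber kappa (kappa i)) w).
  by rewrite !inE eqxx.
- by apply/familyP => k; rewrite ffunE; apply: restr_perm_on.
- have wP : [forall i, w i == split w (kappa i) i].
    by apply/forallP => i; rewrite ffunE restr_fiberE ?eqxx.
  rewrite /glue; case: pickP => [v /forallP vP /= | /(_ w)]; last by rewrite wP.
  by apply/eqP/permP => i; rewrite (eqP (vP i)) -(eqP (forallP wP i)).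
Qed.

(** The analogue of prod_sum_perm_on for functions, where being equal to p0
    outside the fiber replaces fixing the points outside it. *)
Lemma prod_sum_support (P : finType) (p0 : P) (F : D -> {ffun T -> P} -> A) :
  \prod_k \sum_(p : {ffun T -> P} | p0.-support p \subset fiber kappa k) F k p =
  \sum_(p : {ffun T -> P}) \prod_k F k [ffun i => if kappa i == k then p i else p0].
Proof.
have suppP k (p : {ffun T -> P}) :
    reflect (forall i, kappa i != k -> p i = p0) (p0.-support p \subset fiber kappa k).
  apply: (iffP subsetP) => [sp i | sp i].
    apply: contraNeq => pi; have := sp i.
    by rewrite inE => /(_ pi); rewrite inE.
  by rewrite !inE; apply: contraR => /sp ->.
rewrite bigA_distr_big_dep.
pose split (p : {ffun T -> P}) : {ffun D -> {ffun T -> P}} :=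
  [ffun k => [ffun i => if kappa i == k then p i else p0]].
pose glue (g : {ffun D -> {ffun T -> P}}) : {ffun T -> P} :=
  [ffun i => g (kappa i) i].
rewrite (reindex_onto split glue) => [|g /familyP gP]; last first.
  apply/ffunP => k; apply/ffunP => i; rewrite !ffunE.
  by case: eqP => [-> // | /eqP ik]; rewrite (suppP _ _ (gP k)).
apply: eq_big => [p | p _]; last by apply: eq_bigr => k _; rewrite ffunE.
apply/andP; split; last by apply/eqP/ffunP => i; rewrite !ffunE eqxx.
apply/familyP => k; rewrite ffunE; apply/suppP => i ik.
by rewrite ffunE (negPf ik).
Qed.

End Distribution.

(** * Transport along an injection *)

Section Injection.
Variables (S T : finType) (e : S -> T).
Hypothesis e_inj : injective e.
Local Notation I := [set i in codom e].

Definition preim_opt (i : T) : option S := [pick a | e a == i].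

Lemma preim_optK a : preim_opt (e a) = Some a.
Proof.
rewrite /preim_opt; case: pickP => [b /eqP/e_inj -> // | /(_ a)].
by rewrite eqxx.
Qed.

Variant preim_opt_spec i : option S -> Type :=
  | PreimSome a of i = e a : preim_opt_spec i (Some a)
  | PreimNone of i \notin I : preim_opt_spec i None.

Lemma preim_optP i : preim_opt_spec i (preim_opt i).
Proof.
rewrite /preim_opt; case: pickP => [a /eqP <- | iN]; first by left.
by right; rewrite inE; apply/codomP => -[a ia]; have := iN a; rewrite ia eqxx.
Qed.

Lemma mem_image a : e a \in I. Proof. by rewrite inE codom_f. Qed.

Definition push_fun (u : {perm S}) i := if preim_opt i is Some a then e (u a) else i.

Lemma push_fun_inj u : injective (push_fun u).
Proof.
move=> i j; rewrite /push_fun.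
case: preim_optP => [a -> | iN]; case: preim_optP => [b -> | jN] //.
- by move=> /e_inj/perm_inj ->.
- by move=> ij; rewrite -ij mem_image in jN.
- by move=> ij; rewrite ij mem_image in iN.
Qed.

Definition push_perm u : {perm T} := perm (@push_fun_inj u).

Lemma push_permE u a : push_perm u (e a) = e (u a).
Proof. by rewrite permE /push_fun preim_optK. Qed.

Lemma push_perm_out u i : i \notin I -> push_perm u i = i.
Proof.
rewrite permE /push_fun; case: preim_optP => // a -> /negP[].
exact: mem_image.
Qed.

Lemma push_perm_on u : perm_on I (push_perm u).
Proof. by apply/subsetP => i; apply: contraR => /(push_perm_out u) ->. Qed.

Lemma push_permP (u : {perm S}) (v : {perm T}) :
  (forall a, v (e a) = e (u a)) -> perm_on I v -> v = push_perm u.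
Proof.
move=> vu vI; apply/permP => i; case: (preim_optP i) => [a -> | iN].
  by rewrite push_permE.
by rewrite push_perm_out // (out_perm vI).
Qed.

Lemma push_perm_inj : injective push_perm.
Proof.
move=> u v uv; apply/permP => a; apply: e_inj.
by rewrite -!push_permE uv.
Qed.

(** The extension maps the transposition of a and b to that of e a and e b, and
    transpositions generate. *)
Lemma odd_push_perm u : push_perm u = u :> bool.
Proof.
have [ts -> dts] := prod_tpermP u; elim: ts dts => [|[a b] ts IHts] /=.
  move=> _; rewrite big_nil -(push_permP (u := 1%g) (v := 1%g)) ?odd_perm1 //.
    by move=> a; rewrite !perm1.
  exact: perm_on1.
case/andP=> ab /IHts; rewrite big_cons /=; set v := (\prod_(_ <- _) _)%g => Ev.
rewrite odd_permM -Ev -(push_permP (u := (tperm a b * v)%g) (v := (tperm (e a) (e b) * push_perm v)%g)).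
- by rewrite odd_permM !odd_tperm (inj_eq e_inj).
- by move=> c; rewrite !permM -(inj_tperm _ _ _ e_inj) push_permE.
apply: perm_onM (push_perm_on v); apply: subset_trans (tperm_on _ _) _.
by apply/subsetP => _ /set2P[] ->; apply: mem_image.
Qed.

Lemma one_dim_val_push b u : one_dim_val b (push_perm u) = one_dim_val b u.
Proof. by case: b => //=; rewrite odd_push_perm. Qed.

Lemma sum_push_perm (V : nmodType) (F : {perm T} -> V) :
  \sum_(w | perm_on I w) F w = \sum_u F (push_perm u).
Proof.
pose pull w := odflt 1%g [pick u | push_perm u == w].
have pullK u : pull (push_perm u) = u.
  rewrite /pull; case: pickP => [v /eqP/push_perm_inj // | /(_ u)].
  by rewrite eqxx.
rewrite (reindex_onto push_perm pull) => [|w wI]; last first.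
  suff [u ->] : exists u, w = push_perm u by rewrite pullK.
  have ex a : exists b, w (e a) = e b.
    have : w (e a) \in I by rewrite (perm_closed _ wI) mem_image.
    by rewrite inE => /codomP.
  have [u wu] := fin_all_exists ex.
  have u_inj : injective u.
    by move=> a b uab; apply/e_inj/(@perm_inj _ w); rewrite !wu uab.
  by exists (perm u_inj); apply: push_permP => // a; rewrite permE.
by apply: eq_bigl => u; rewrite push_perm_on pullK eqxx.
Qed.

Variables (P : finType) (p0 : P).

Definition push_label (q : {ffun S -> P}) : {ffun T -> P} :=
  [ffun i => if preim_opt i is Some a then q a else p0].

Lemma sum_push_label (V : nmodType) (F : {ffun T -> P} -> V) :
  \sum_(p : {ffun T -> P} | p0.-support p \subset I) F p = \sum_(q : {ffun S -> P}) F (push_label q).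
Proof.
rewrite (reindex_onto push_label (fun p => [ffun a => p (e a)])) => [|p /subsetP pI].
  apply: eq_bigl => q; apply/andP; split.
    by apply/subsetP => i; rewrite !inE ffunE; case: preim_optP => [a -> _|];
       rewrite ?codom_f ?eqxx.
  by apply/eqP/ffunP => a; rewrite !ffunE preim_optK.
apply/ffunP => i; rewrite ffunE; case: preim_optP => [a -> | iN].
  by rewrite ffunE.
by apply/esym/eqP; apply: contraR iN => /pI.
Qed.

End Injection.

(** * Monomial characters of symmetric groups *)

Lemma card_ord_interval m a l : (a + l <= m)%N ->
  #|[set i : 'I_m | (a <= i < a + l)%N]| = l.
Proof.
elim: l => [|l IHl] al_m.
  by apply: eq_card0 => i; rewrite inE addn0 ltnNge andbN.
rewrite addnS in al_m; rewrite -[in RHS](IHl (ltnW al_m)).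
rewrite (cardsD1 (Ordinal al_m)) inE leq_addr addnS leqnn; congr (_ + _)%N.
apply: eq_card => i; rewrite !inE ltnS -val_eqE /= andbCA [(i < _)%N]ltn_neqAle.
by [].
Qed.

Lemma sumn_nth (s : seq nat) N : (size s <= N)%N -> sumn s = (\sum_(i < N) nth 0 s i)%N.
Proof.
move=> sN; have -> : sumn s = (\sum_(i < size s) nth 0 s i)%N.
  by rewrite sumnE (big_nth 0%N) big_mkord.
rewrite (big_ord_widen _ (fun i => nth 0%N s i) sN) big_mkcond.
by apply: eq_bigr => i _ /=; case: ltnP => // /(nth_default 0%N) ->.
Qed.

Lemma one_dim_valJ b (T : finType) (u v : {perm T}) :
  one_dim_val b (u ^ v)%g = one_dim_val b u.
Proof. by case: b => //=; rewrite odd_permJ. Qed.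

Lemma one_dim_valV b (T : finType) (u : {perm T}) :
  one_dim_val b u^-1%g = one_dim_val b u.
Proof. by case: b => //=; rewrite odd_permV. Qed.

(** The stabilizer of a relabelling is the conjugate stabilizer; this turns
    membership of u ^ v in a Young subgroup into a condition on the labelling
    produced by v. *)
Lemma relabel_fixJ (T L : finType) (f : {ffun T -> L}) (u v : {perm T}) :
  (relabel f (u ^ v)%g == f) = (relabel (relabel f v) u == relabel f v).
Proof.
rewrite conjgE !relabelM; apply/eqP/eqP => [fv | ->].
  by rewrite -[LHS]relabel1 -(mulgV v) relabelM fv.
by rewrite -relabelM mulVg relabel1.
Qed.

Section SymMonomial.
Variables (m N : nat) (s : seq nat) (b : one_dim).
Hypotheses (sum_s : sumn s = m) (size_s : (size s <= N)%N).

Lemma young_blockE (i : 'I_N) :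
  young_block m s i = [set j : 'I_m | (sumn (take i s) <= j < sumn (take i s) + nth 0 s i)%N].
Proof.
apply/setP => j; rewrite !inE; have [i_s | s_i] := ltnP i (size s).
  by rewrite sumn_takeS.
rewrite !take_oversize ?nth_default ?addn0 //.
exact: leq_trans s_i _.
Qed.

Lemma card_young_block (i : 'I_N) : #|young_block m s i| = nth 0%N s i.
Proof.
rewrite young_blockE card_ord_interval //; have [i_s | s_i] := ltnP i (size s).
  by rewrite -sumn_takeS // -sum_s -{2}[s]take_size sumn_take.
by rewrite nth_default // addn0 take_oversize // sum_s.
Qed.

Lemma young_labelling :
  exists q : {ffun 'I_m -> 'I_N}, forall i, fiber q i = young_block m s i.
Proof.
apply: labelling_of_disjoint; last first.
  rewrite card_ord -[RHS]sum_s (sumn_nth size_s).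
  by apply: eq_bigr => i _; apply: card_young_block.
have lt_dis (i j : 'I_N) : (i < j)%N -> [disjoint young_block m s i & young_block m s j].
  move=> ij; rewrite disjoint_subset; apply/subsetP => k; rewrite !inE => /andP[_ ki].
  by rewrite negb_and -ltnNge (leq_trans ki) ?sumn_take.
move=> i j; rewrite -val_eqE /= neq_ltn => /orP[] /lt_dis //.
by rewrite disjoint_sym.
Qed.

Lemma mem_young_group (q : {ffun 'I_m -> 'I_N}) u :
    (forall i, fiber q i = young_block m s i) ->
  (u \in young_group m s) = (relabel q u == q).
Proof.
move=> qs; apply/bigcapP/idP => [Yu | qu i _].
  apply/relabel_fixP => j; apply/eqP.
  have : j \in fiber q (q j) by rewrite inE.
  have [lt_qj | ge_qj] := ltnP (q j) (size s); last first.
    by rewrite qs young_blockE inE nth_default // addn0 ltnNge andbN.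
  have /astabsP/(_ j) := Yu (Ordinal lt_qj) isT.
  by rewrite /= apermE -qs => <-; rewrite inE.
have i_N : (i < N)%N := leq_trans (ltn_ord i) size_s.
by rewrite -[i : nat]/(Ordinal i_N : nat) -qs; apply: fiber_stable.
Qed.

(** Labellings of type s are the cosets of the Young subgroup, so the induced
    trivial character counts the labellings fixed by u; the factor b comes out
    because it is constant on conjugates. *)
Lemma sym_monomial_charE (u : 'S_m) :
  sym_monomial_char m s b u = one_dim_val b u *
    \sum_(q : {ffun 'I_m -> 'I_N} | [forall i, #|fiber q i| == nth 0%N s i])
       (relabel q u == q)%:R.
Proof.
have [q0 q0s] := young_labelling.
have card_q0 i : #|fiber q0 i| = nth 0%N s i by rewrite q0s card_young_block.
rewrite /sym_monomial_char cfIndE ?subsetT //.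
rewrite (eq_bigr (fun v => one_dim_val b u * (relabel (relabel q0 v) u == relabel q0 v)%:R)).
  rewrite (eq_bigl xpredT) => [|v]; last by rewrite inE.
  rewrite -mulr_sumr mulrCA; congr (_ * _).
  rewrite (sum_relabel (fun q => (relabel q u == q)%:R)).
  have -> : #|[set v | relabel q0 v == q0]| = #|young_group m s|.
    by apply: eq_card => v; rewrite (mem_young_group _ q0s) inE.
  rewrite -[X in _ * X]mulr_natl mulKf ?pnatr_eq0 -?lt0n ?cardG_gt0 //.
  by apply: eq_bigl => q; apply: eq_forallb => i; rewrite card_q0.
move=> v _; have [uvY | uvN] := boolP ((u ^ v)%g \in young_group m s).
  rewrite cfResE ?subsetT // cfunE one_dim_valJ -relabel_fixJ.
  by rewrite -(mem_young_group _ q0s) uvY mulr1.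
by rewrite cfun0 // -relabel_fixJ -(mem_young_group _ q0s) (negPf uvN) mulr0.
Qed.

End SymMonomial.

Section Transfer.
Variables (m N : nat) (I : {set 'I_m}) (s : seq nat) (b : one_dim).
Hypotheses (sum_s : sumn s = #|I|) (size_s : (size s <= N.+1)%N).

(** The sums over 'S_#|I| and over labellings of 'I_#|I| are moved to the
    ambient index set along enum_val, so that different I may later be combined.
    Permutations are extended by the identity and labellings by ord0 outside I. *)
Lemma Imm_principal_submx (A : comAlgType algC) (Z : 'M[A]_m) :
  Imm (sym_monomial_char #|I| s b) (principal_submx Z I) =
  \sum_(w | perm_on I w)
    (one_dim_val b w *
     \sum_(p : {ffun 'I_m -> 'I_N.+1} | ord0.-support p \subset I)
       ([forall l, #|fiber p l :&: I| == nth 0%N s l] && (relabel p w == p))%:R)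
    *: \prod_(i in I) Z i (w i).
Proof.
pose e : 'I_#|I| -> 'I_m := @enum_val _ (mem I).
have e_inj : injective e := @enum_val_inj _ _.
have memI i : (i \in I) = (i \in codom e).
  apply/idP/codomP => [iI | [a ->]]; last exact: enum_valP.
  by exists (enum_rank_in iI i); rewrite /e enum_rankK_in.
have IE : [set i in codom e] = I by apply/setP => i; rewrite inE memI.
rewrite [RHS](eq_bigl (perm_on [set i in codom e])) => [|w]; last by rewrite IE.
rewrite (sum_push_perm e_inj) /Imm; apply: eq_bigr => u _.
rewrite (sym_monomial_charE b sum_s size_s) one_dim_val_push; congr (_ * _ *: _).
  rewrite [RHS](eq_bigl (fun p : {ffun 'I_m -> 'I_N.+1} =>
    ord0.-support p \subset [set i in codom e])) => [|p]; last by rewrite IE.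
  rewrite (sum_push_label e_inj) big_mkcond; apply: eq_bigr => q _.
  have -> : (relabel (push_label e ord0 q) (push_perm e_inj u) == push_label e ord0 q)
      = (relabel q u == q).
    apply/relabel_fixP/relabel_fixP => qu.
      by move=> a; have := qu (e a); rewrite push_permE !ffunE !preim_optK.
    move=> i; case: (preim_optP e i) => [a -> | iN].
      by rewrite push_permE !ffunE !preim_optK.
    by rewrite push_perm_out.
  have -> : [forall l, #|fiber (push_label e ord0 q) l :&: I| == nth 0%N s l]
      = [forall l, #|fiber q l| == nth 0%N s l].
    apply: eq_forallb => l; rewrite -(card_imset _ e_inj); congr (_ == _).
    apply: eq_card => i; rewrite in_setI memI inE ffunE.
    case: preim_optP => [a -> | iN]; first by rewrite codom_f andbT mem_imset // inE.
    move: iN; rewrite inE => iN; rewrite (negPf iN) andbF; apply/esym/negbTE.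
    by apply: contra iN => /imsetP[a _ ->]; apply: codom_f.
  by case: ifP.
rewrite [RHS]big_enum_val; apply: eq_bigr => a _.
by rewrite mxE push_permE.
Qed.

End Transfer.

(** * The right-hand side as a sum over labellings *)

Lemma prod_natr_bool (R : comPzSemiRingType) (I : finType) (c : pred I) :
  \prod_i (c i)%:R = [forall i, c i]%:R :> R.
Proof.
have [/forallP c1 | /forallPn[i /negPf ci]] := boolP [forall i, c i].
  by rewrite big1 // => i _; rewrite c1.
by rewrite (bigD1 i) //= ci mul0r.
Qed.

(** As the sizes add up to n + 1, the parts cover all positions, so an ordered
    set partition is the sequence of fibers of a coloring kappa. *)
Lemma sum_ordered_set_partition d n (a : 'I_d.+1 -> nat) (V : nmodType)
    (G : {ffun 'I_d.+1 -> {set 'I_n.+1}} -> V) : (\sum_k a k)%N = n.+1 ->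
  \sum_(I | ordered_set_partition a I) G I =
  \sum_(kappa : {ffun 'I_n.+1 -> 'I_d.+1} | [forall k, #|fiber kappa k| == a k])
    G [ffun k => fiber kappa k].
Proof.
move=> sum_a; pose h (kappa : {ffun 'I_n.+1 -> 'I_d.+1}) := [ffun k => fiber kappa k].
pose h' (I : {ffun 'I_d.+1 -> {set 'I_n.+1}}) := [ffun i => odflt ord0 [pick k | i \in I k]].
rewrite (reindex_onto h h') => [|I /andP[/forallP cI /forallP dI]].
  apply: eq_bigl => kappa; rewrite andbC; case: eqP => [_ | []] /=.
    apply/andP/idP => [[/forallP ck _] | /forallP ck].
      by apply/forallP => k; have := ck k; rewrite ffunE.
    split; apply/forallP => k; first by rewrite ffunE.
    apply/forallP => l; apply/implyP => kl; rewrite !ffunE.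
    rewrite disjoint_subset; apply/subsetP => i; rewrite !inE => /eqP ->.
    by [].
  apply/ffunP => i; rewrite ffunE; case: pickP => [k | /(_ (kappa i))].
    by rewrite ffunE inE => /eqP.
  by rewrite ffunE inE eqxx.
have [||kappa kI] := labelling_of_disjoint (S := I).
- by move=> k l kl; have /forallP/(_ l)/implyP := dI k; apply.
- by rewrite card_ord -[RHS]sum_a; apply: eq_bigr => k _; apply/eqP.
apply/ffunP => k; rewrite ffunE -kI; apply/setP => i; rewrite !inE ffunE.
case: pickP => [l | /(_ (kappa i))]; first by rewrite -kI inE => /eqP ->.
by rewrite -kI inE eqxx.
Qed.

Definition pair_label (T D P : finType) (kappa : {ffun T -> D}) (p : {ffun T -> P}) :
  {ffun T -> D * P} := [ffun i => (kappa i, p i)].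
Definition label1 (T D P : finType) (f : {ffun T -> D * P}) : {ffun T -> D} :=
  [ffun i => (f i).1].
Definition label2 (T D P : finType) (f : {ffun T -> D * P}) : {ffun T -> P} :=
  [ffun i => (f i).2].

Lemma pair_labelK (T D P : finType) (f : {ffun T -> D * P}) :
  pair_label (label1 f) (label2 f) = f.
Proof. by apply/ffunP => i; rewrite !ffunE; case: (f i). Qed.

Lemma label1_pair (T D P : finType) (kappa : {ffun T -> D}) (p : {ffun T -> P}) :
  label1 (pair_label kappa p) = kappa.
Proof. by apply/ffunP => i; rewrite !ffunE. Qed.

Lemma label2_pair (T D P : finType) (kappa : {ffun T -> D}) (p : {ffun T -> P}) :
  label2 (pair_label kappa p) = p.
Proof. by apply/ffunP => i; rewrite !ffunE. Qed.

Lemma relabel_pair (T D P : finType) (kappa : {ffun T -> D}) (p : {ffun T -> P}) w :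
  (relabel (pair_label kappa p) w == pair_label kappa p) =
  (relabel kappa w == kappa) && (relabel p w == p).
Proof.
apply/relabel_fixP/andP => [fw | [/relabel_fixP kw /relabel_fixP pw] i].
  by split; apply/relabel_fixP => i; have := fw i; rewrite !ffunE => -[].
by rewrite !ffunE kw pw.
Qed.

Lemma relabel_label1 (T D P : finType) (f : {ffun T -> D * P}) w :
  relabel f w == f -> relabel (label1 f) w == label1 f.
Proof. by move=> /relabel_fixP fw; apply/relabel_fixP => i; rewrite !ffunE fw. Qed.

Section Labelled.
Variables (d n : nat) (lam : dpartition d n) (beta : 'I_d.+1 -> one_dim).
Local Notation label := ('I_d.+1 * 'I_n.+1)%type.

(** All part indices range over 'I_n.+1, as no partition has more than n + 1
    parts; a label (k, l) beyond the last part of lam k has an empty fiber because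
    the default value of nth is 0. *)
Definition has_type (f : {ffun 'I_n.+1 -> label}) :=
  [forall l, #|fiber f l| == nth 0%N (lam l.1) l.2].

Definition beta_weight (kappa : {ffun 'I_n.+1 -> 'I_d.+1}) (w : 'S_n.+1) : algC :=
  \prod_k one_dim_val (beta k) (restr_perm (fiber kappa k) w).

Lemma size_dpart k : (size (lam k) <= n.+1)%N.
Proof.
have /andP[_ pos] := dpart_part lam k.
have le_sum : (size (lam k) <= sumn (lam k))%N.
  elim: (dpart lam k) pos => [|x s IHs] //= /andP[x_gt0 /IHs].
  by rewrite -add1n; apply: leq_add.
apply: leq_trans le_sum _; rewrite -(dpart_sum lam) (bigD1 k) //=.
exact: leq_addr.
Qed.

Lemma has_type_label1 f k : has_type f -> #|fiber (label1 f) k| = sumn (lam k).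
Proof.
move=> /forallP tf; rewrite (sumn_nth (size_dpart k)).
rewrite -sum1_card (partition_big (label2 f) predT) //=.
apply: eq_bigr => l _; rewrite -(eqP (tf (k, l))) -[RHS]sum1_card; apply: eq_bigl => i.
by rewrite !inE !ffunE -pair_eqE.
Qed.

Variables (A : comAlgType algC) (Z : 'I_d.+1 -> 'M[A]_n.+1).

(** The common value of the two sides of the theorem when Z k is Q_k. *)
Definition labelled_sum : A :=
  \sum_(f | has_type f) \sum_(w : 'S_n.+1 | relabel f w == f)
    beta_weight (label1 f) w *: \prod_i Z (label1 f i) i (w i).

(** A labelling of the whole index set by pairs with first component kappa is
    an independent choice of labellings of the fibers of kappa. *)
Lemma prod_label_count (kappa : {ffun 'I_n.+1 -> 'I_d.+1}) (w : 'S_n.+1) :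
    relabel kappa w == kappa ->
  \prod_k \sum_(p : {ffun 'I_n.+1 -> 'I_n.+1} | ord0.-support p \subset fiber kappa k)
     ([forall l, #|fiber p l :&: fiber kappa k| == nth 0%N (lam k) l]
      && (relabel p (restr_perm (fiber kappa k) w) == p))%:R =
  \sum_(p : {ffun 'I_n.+1 -> 'I_n.+1})
     (has_type (pair_label kappa p) && (relabel p w == p))%:R :> algC.
Proof.
move=> kw; rewrite (prod_sum_support kappa).
apply: eq_bigr => p _; rewrite prod_natr_bool; congr (_%:R).
pose q k := [ffun i => if kappa i == k then p i else ord0] : {ffun 'I_n.+1 -> 'I_n.+1}.
have fib k l : fiber (q k) l :&: fiber kappa k = fiber (pair_label kappa p) (k, l).
  apply/setP => i; rewrite !inE !ffunE -pair_eqE /=.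
  by case: (kappa i == k); rewrite ?andbT ?andbF.
congr nat_of_bool; apply/forallP/andP => [all_k | [/forallP tf /relabel_fixP pw] k].
  split.
    apply/forallP => -[k l]; rewrite -fib.
    by have /andP[/forallP/(_ l)] := all_k k.
  apply/relabel_fixP => i; have /andP[_ /relabel_fixP/(_ i)] := all_k (kappa i).
  by rewrite restr_fiberE // eqxx !ffunE (relabel_fixP _ _ kw) eqxx.
apply/andP; split; first by apply/forallP => l; rewrite fib; apply: (tf (k, l)).
apply/relabel_fixP => i; rewrite restr_fiberE //; case: ifP => // ik.
by rewrite !ffunE (relabel_fixP _ _ kw) ik pw.
Qed.

Lemma sum_prod_Imm :
  \sum_(I : {ffun 'I_d.+1 -> {set 'I_n.+1}}
         | ordered_set_partition (fun k => sumn (lam k)) I)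
    \prod_(k < d.+1)
      Imm (sym_monomial_char #|I k| (lam k) (beta k)) (principal_submx (Z k) (I k))
  = labelled_sum.
Proof.
rewrite sum_ordered_set_partition ?dpart_sum //.
transitivity (\sum_(kappa : {ffun 'I_n.+1 -> 'I_d.+1}
       | [forall k, #|fiber kappa k| == sumn (lam k)])
    \sum_(w : 'S_n.+1 | relabel kappa w == kappa)
    \sum_(p : {ffun 'I_n.+1 -> 'I_n.+1} | has_type (pair_label kappa p) && (relabel p w == p))
      beta_weight kappa w *: \prod_i Z (kappa i) i (w i)).
  apply: eq_bigr => kappa /forallP ck.
  under eq_bigr => k _.
    rewrite (Imm_principal_submx (N := n)) ?size_dpart ?ffunE ?(eqP (ck k)) //.
    over.
  rewrite prod_sum_perm_on; apply: eq_bigr => w kw.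
  rewrite scaler_prod big_split /= prod_label_count // -/(beta_weight kappa w).
  have -> : \prod_k \prod_(i in fiber kappa k) Z k i (restr_perm (fiber kappa k) w i)
      = \prod_i Z (kappa i) i (w i).
    rewrite [RHS](partition_big kappa predT) //=; apply: eq_bigr => k _.
    apply: eq_big => [i | i ik]; first by rewrite inE.
    by move: ik; rewrite restr_fiberE // inE => ik; rewrite ik (eqP ik).
  rewrite mulr_sumr scaler_suml [RHS]big_mkcond; apply: eq_bigr => p _.
  by case: ifP; rewrite ?mulr1 // mulr0 scale0r.
rewrite /labelled_sum (reindex (fun kp => pair_label kp.1 kp.2)); last first.
  exists (fun f => (label1 f, label2 f)) => [[kappa p] _ | f _] /=.
    by rewrite label1_pair label2_pair.
  exact: pair_labelK.
rewrite (eq_bigl (fun kp : {ffun 'I_n.+1 -> 'I_d.+1} * {ffun 'I_n.+1 -> 'I_n.+1} =>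
    [forall k, #|fiber kp.1 k| == sumn (lam k)]
                           && has_type (pair_label kp.1 kp.2))) => [|[kappa p]] /=.
  rewrite -(pair_big_dep (fun kappa : {ffun 'I_n.+1 -> 'I_d.+1} =>
      [forall k, #|fiber kappa k| == sumn (lam k)])
    (fun kappa (p : {ffun 'I_n.+1 -> 'I_n.+1}) => has_type (pair_label kappa p))
    (fun kappa p => \sum_(w : 'S_n.+1 | relabel (pair_label kappa p) w == pair_label kappa p)
      beta_weight (label1 (pair_label kappa p)) w *:
      \prod_i Z (label1 (pair_label kappa p) i) i (w i))) /=.
  apply: eq_bigr => kappa _.
  rewrite (exchange_big_dep (fun p : {ffun 'I_n.+1 -> 'I_n.+1} => has_type (pair_label kappa p))) /=; last first.
    by move=> w p _ /andP[].
  apply: eq_bigr => p tp; rewrite label1_pair; apply: eq_bigl => w.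
  by rewrite tp relabel_pair.
case tp: (has_type _); rewrite ?andbF // andbT; apply/esym/forallP => k.
by rewrite -(has_type_label1 k tp) label1_pair.
Qed.

End Labelled.

(** * Generation of the wreath product of an interval *)

Section IntervalGroup.
Variables d n : nat.
Local Notation W := (wreath d n).

Definition of_perm (w : 'S_n.+1) : W := Wreath [ffun=> 0] w.
Definition of_color (c : {ffun 'I_n.+1 -> 'I_d.+1}) : W := Wreath c 1%g.
Definition unit_color (i : 'I_n.+1) : {ffun 'I_n.+1 -> 'I_d.+1} :=
  [ffun j => if j == i then inZp 1 else 0].

Lemma of_permM v w : of_perm (v * w) = (of_perm v * of_perm w)%g.
Proof. by apply: wreath_eq => [i|] //; rewrite colorM !ffunE add0r. Qed.

Lemma of_colorD c c' : of_color (c + c') = (of_color c * of_color c')%g.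
Proof. by apply: wreath_eq => [i|] /=; rewrite ?mulg1 // !ffunE perm1. Qed.

Lemma of_color0 : of_color 0 = 1%g.
Proof. by apply: wreath_eq => // i; rewrite !ffunE. Qed.

Lemma wreath_decomp (g : W) : g = (of_color (color g) * of_perm (under g))%g.
Proof. by apply: wreath_eq => [i|]; rewrite ?underM ?mul1g // colorM !ffunE addr0. Qed.

Lemma color_decomp (c : {ffun 'I_n.+1 -> 'I_d.+1}) : c = \sum_i unit_color i *+ c i.
Proof.
apply/ffunP => j; rewrite sum_ffunE (bigD1 j) //= big1 => [|i ij].
  rewrite [RHS]addr0 ffunMnE ffunE eqxx Zp_mulrn.
  by apply/val_inj; rewrite /= modnMml mul1n modn_small.
by rewrite ffunMnE ffunE eq_sym (negPf ij) mul0rn.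
Qed.

Lemma inord_eq i j : (i <= n)%N -> (j <= n)%N ->
  (inord i == inord j :> 'I_n.+1) = (i == j).
Proof. by move=> i_n j_n; rewrite -val_eqE /= !inordK. Qed.

(** Conjugating t by transpositions moves its single nonzero color from
    position 0 to position i. *)
Lemma t_E i : (i <= n)%N -> t_ d n i = of_color (unit_color (inord i)).
Proof.
elim: i => [_ | i IHi i_n] /=.
  suff -> : inord 0 = ord0 :> 'I_n.+1 by [].
  by apply/val_inj; rewrite /= inordK.
rewrite IHi ?(ltnW i_n) //; apply: wreath_eq => [j|].
  rewrite !colorM !ffunE add0r addr0 /= (can2_eq (tpermK _ _) (tpermK _ _)) tpermL.
  by [].
by rewrite !underM mulg1 tperm2.
Qed.

Variables a m : nat.
Hypothesis am_n : (a + m <= n)%N.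
Local Notation H := (interval_group d n a m.+1).

Lemma s_mem i : (i < m)%N -> s_ d n (a + i) \in H.
Proof.
move=> lt_im; rewrite mem_gen // inE; apply/orP; right.
by apply/imsetP; exists (Ordinal lt_im).
Qed.

Lemma t_mem i : (i <= m)%N -> t_ d n (a + i) \in H.
Proof.
elim: i => [_ | i IHi lt_im]; first by rewrite addn0 mem_gen ?setU11.
by rewrite addnS /= !groupM ?s_mem ?IHi // ltnW.
Qed.

Lemma tperm_mem i j : (i < j <= m)%N ->
  of_perm (tperm (inord (a + i)) (inord (a + j))) \in H.
Proof.
elim: j => [//|j IHj] /andP[]; rewrite ltnS leq_eqVlt => /orP[/eqP -> | lt_ij] lt_jm.
  by rewrite addnS; apply: s_mem.
have le_n k : (k <= m)%N -> (a + k <= n)%N.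
  by move=> km; apply: leq_trans am_n; rewrite leq_add2l.
rewrite addnS.
suff -> : of_perm (tperm (inord (a + i)) (inord (a + j).+1)) =
    (s_ d n (a + j) * of_perm (tperm (inord (a + i)) (inord (a + j))) * s_ d n (a + j))%g.
  by rewrite !groupM ?s_mem ?IHj // lt_ij ltnW.
rewrite -/(of_perm (tperm (inord (a + j)) (inord (a + j).+1))) -!of_permM; congr of_perm.
rewrite -[X in (X * _ * _)%g]tpermV -mulgA -conjgE tpermJ tpermL tpermD //.
  rewrite inord_eq ?le_n //; last by rewrite ltnW // (ltn_trans lt_ij).
    by rewrite eqn_add2l gtn_eqF.
  by rewrite ltnW.
rewrite -addnS inord_eq ?le_n //; last by rewrite ltnW // (ltn_trans lt_ij).
by rewrite eqn_add2l gtn_eqF // ltnS ltnW.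
Qed.

(** Induction on the length of the interval: composing w with the transposition
    of the last point x and its image w x yields a permutation that fixes x. *)
Lemma of_perm_mem l w : (l <= m.+1)%N -> perm_on (Defs.interval n a l) w -> of_perm w \in H.
Proof.
elim: l w => [|l IHl] w lm wP.
  have -> : w = 1%g.
    apply: perm_on_id wP _; rewrite eq_card0 // => i.
    by rewrite inE addn0 ltnNge andbN.
  by rewrite (_ : of_perm 1 = 1%g) // group1.
have le_n k : (k <= l)%N -> (a + k <= n)%N.
  by move=> kl; apply: leq_trans am_n; rewrite leq_add2l (leq_trans kl).
pose x : 'I_n.+1 := inord (a + l).
have val_x : x = (a + l)%N :> nat by rewrite inordK // ltnS le_n.
have w'P : perm_on (Defs.interval n a l) (w * tperm (w x) x)%g.
  apply/subsetP => i; apply: contraR => i_out.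
  rewrite permM; have [-> | ix] := eqVneq i x; first by rewrite tpermL.
  have i_al : (i == (a + l)%N :> nat) = false by rewrite -val_x; apply: negPf ix.
  have i_out' : i \notin Defs.interval n a l.+1.
    by apply: contra i_out; rewrite !inE addnS ltnS [(i <= _)%N]leq_eqVlt i_al.
  rewrite [w i](out_perm wP) // tpermD //; last by rewrite eq_sym.
  apply: contraNneq ix => wx; apply/eqP/(@perm_inj _ w).
  by rewrite [w i](out_perm wP).
rewrite -[w](mulgKV (tperm (w x) x)) tpermV of_permM.
apply: groupM; first exact: IHl (ltnW lm) w'P.
have : w x \in Defs.interval n a l.+1.
  by rewrite perm_closed // inE val_x leq_addr addnS ltnS leqnn.
rewrite inE addnS ltnS => /andP[a_wx wx_al].
have wxE : w x = inord (a + (w x - a)) by rewrite subnKC // inord_val.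
have [wx | wx_neq] := eqVneq (w x) x.
  by rewrite wx tperm1 (_ : of_perm 1 = 1%g) // group1.
have l_m : (l <= m)%N by rewrite -ltnS.
rewrite wxE tperm_mem // l_m andbT ltn_subLR // ltn_neqAle wx_al andbT.
by rewrite -val_x.
Qed.

(** With interval_moves this identifies the interval group with the group of all
    elements that move only positions of the interval. *)
Lemma moves_in_interval : moves_in d (Defs.interval n a m.+1) \subset H.
Proof.
apply/subsetP => g gP; rewrite (wreath_decomp g) groupM //; last first.
  apply: (of_perm_mem (leqnn _)); apply/subsetP => i; apply: contraR.
  by case/(moves_inP _ _ gP) => _ ->.
rewrite (color_decomp (color g)).
elim/big_ind: _ => [|c c' cH c'H|i _]; rewrite ?of_color0 ?of_colorD ?groupM //.
have [iI | /(moves_inP _ _ gP)[-> _]] := boolP (i \in Defs.interval n a m.+1); last first.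
  by rewrite mulr0n of_color0 group1.
suff iH : of_color (unit_color i) \in H.
  by elim: (color g i : nat) => [|k IHk]; rewrite ?mulr0n ?of_color0 // mulrS of_colorD groupM.
move: iI; rewrite inE addnS ltnS => /andP[ai i_am].
rewrite -[i]inord_val -(subnKC ai) -t_E ?t_mem ?leq_subLR //.
by rewrite subnKC // -ltnS.
Qed.

End IntervalGroup.

(** * Young subgroups of the wreath product *)

Section Cut.
Variables (d n : nat) (D : finType) (f : {ffun 'I_n.+1 -> D}).
Local Notation W := (wreath d n).
Implicit Types (g : W) (l : D).

(** The factor of g that acts on the fiber of l only; it is meaningful when the
    underlying permutation of g preserves f. *)
Definition cut g l : W :=
  Wreath [ffun i => if f i == l then color g i else 0] (restr_perm (fiber f l) (under g)).

Lemma cut_moves_in g l : cut g l \in moves_in d (fiber f l).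
Proof.
apply/moves_inP => i il; rewrite /= ffunE (out_perm (restr_perm_on _ _) il).
by move: il; rewrite inE => /negPf ->.
Qed.

(** The factors act on disjoint sets of positions, so at every position exactly
    one of them is felt, whatever the order of the product. *)
Lemma cut_prod g : relabel f (under g) == f -> g = (\prod_l cut g l)%g.
Proof.
move=> fg; have prefix_prod (r : seq D) : uniq r ->
    (forall i, color (\prod_(l <- r) cut g l)%g i = if f i \in r then color g i else 0)
    /\ (forall i, under (\prod_(l <- r) cut g l)%g i = if f i \in r then under g i else i).
  elim: r => [_|l r IHr /= /andP[lr /IHr[IHc IHu]]].
    by rewrite big_nil; split=> i; rewrite ?color1 ?perm1.
  rewrite big_cons; have fcut i : f (under (cut g l) i) = f i.
    by rewrite /= restr_fiberE //; case: ifP => // _; rewrite (relabel_fixP _ _ fg).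
  split=> i.
    rewrite colorM IHc fcut inE ffunE /= restr_fiberE //; case: eqP => [-> | _] /=.
      by rewrite (negPf lr) addr0.
    by rewrite add0r.
  rewrite underM permM IHu fcut inE /= restr_fiberE //; case: eqP => [-> | _] //=.
  by rewrite (negPf lr).
have [gc gu] := prefix_prod _ (index_enum_uniq D).
apply: wreath_eq => [i|]; first by rewrite gc mem_index_enum.
by apply/permP => i; rewrite gu mem_index_enum.
Qed.

Lemma cut_eq1 g l : (forall i, f i = l -> color g i = 0 /\ under g i = i) ->
  relabel f (under g) == f -> cut g l = 1%g.
Proof.
move=> gl fg; apply: wreath_eq => [i|].
  by rewrite color1 ffunE; case: eqP => // /gl[].
apply/permP => i; rewrite perm1 /= restr_fiberE //.
by case: eqP => // /gl[].
Qed.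

End Cut.

Section YoungSubgroup.
Variables (d n : nat) (lam : dpartition d n).
Local Notation W := (wreath d n).
Local Notation label := ('I_d.+1 * 'I_n.+1)%type.

(** The interval K^k_i for the label (k, i); it is empty for labels beyond the
    last part. *)
Definition K_label (l : label) : {set 'I_n.+1} :=
  Defs.interval n (Kstart lam l.1 l.2) (nth 0%N (lam l.1) l.2).

Lemma K_labelE k (i : 'I_n.+1) (lt_i : (i < size (lam k))%N) :
  K_label (k, i) = K_ (Ordinal lt_i).
Proof. by []. Qed.

Lemma K_label_size l i : i \in K_label l -> (l.2 < size (lam l.1))%N.
Proof.
rewrite inE => /andP[le_i lt_i]; rewrite ltnNge; apply/negP => /(nth_default 0%N) l0.
by move: lt_i; rewrite l0 addn0 ltnNge le_i.
Qed.

Lemma K_label_J l : K_label l \subset J_ lam l.1.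
Proof.
case: l => k i; apply/subsetP => j jK; have lt_i := K_label_size jK.
by apply: subsetP (K_J (Ordinal lt_i)) j jK.
Qed.

Lemma card_K_label l : #|K_label l| = nth 0%N (lam l.1) l.2.
Proof.
rewrite card_ord_interval //; have [lt_i | ge_i] := ltnP l.2 (size (lam l.1)).
  by rewrite (Kend (Ordinal lt_i)) (leq_trans (Kstart_le _ _ _)) ?Kstart_max.
by rewrite nth_default // addn0 (leq_trans (Kstart_le _ _ _)) ?Kstart_max.
Qed.

(** The intervals K^k_i are disjoint and their lengths add up to n + 1. *)
Lemma std_labelling : exists f : {ffun 'I_n.+1 -> label}, forall l, fiber f l = K_label l.
Proof.
apply: labelling_of_disjoint => [[k i] [l j] neq |].
  rewrite disjoint_subset; apply/subsetP => x xK; rewrite inE; apply/negP => xL.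
  have [kl | kl] := eqVneq k l; last first.
    have := disjointFr (J_disjoint lam kl) (subsetP (K_label_J (k, i)) _ xK).
    by rewrite (subsetP (K_label_J (l, j)) _ xL).
  move: neq xL; rewrite -{l}kl => neq xL.
  have lt_i := K_label_size xK; have lt_j := K_label_size xL.
  have ij : Ordinal lt_i != Ordinal lt_j.
    by apply: contra neq => /eqP[] ij; apply/eqP; congr (_, _); apply: val_inj.
  by have := disjointFr (K_disjoint ij) xK; rewrite -K_labelE xL.
rewrite card_ord -[RHS](dpart_sum lam).
rewrite (eq_bigr (fun k => \sum_(i < n.+1) nth 0 (lam k) i)%N) => [|k _].
  by rewrite pair_bigA; apply: eq_bigr => l _; rewrite card_K_label.
exact: sumn_nth (size_dpart lam k).
Qed.

Variable f0 : {ffun 'I_n.+1 -> label}.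
Hypothesis f0K : forall l, fiber f0 l = K_label l.

Lemma fiber_label1 k : fiber (label1 f0) k = J_ lam k.
Proof.
have inJ i : i \in J_ lam (label1 f0 i).
  by rewrite ffunE (subsetP (K_label_J _)) // -f0K inE.
apply/setP => i; rewrite inE; apply/eqP/idP => [<- // | ik].
by apply/eqP; apply: contraTT ik => /(J_disjoint lam)/disjointFr ->.
Qed.

Lemma moves_in_G_K k (i : 'I_(size (lam k))) : moves_in d (K_ i) \subset G_K i.
Proof.
rewrite /G_K /K_; have /andP[_ /all_nthP/(_ _ (ltn_ord i)) pos] := dpart_part lam k.
have : (Kstart lam k i + nth 0%N (lam k) i <= n.+1)%N.
  by rewrite Kend (leq_trans (Kstart_le _ _ _)) ?Kstart_max.
have := pos 0%N; case: (nth 0%N (lam k) i) => // m _.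
by rewrite addnS ltnS => am; apply: moves_in_interval.
Qed.

(** Cut g along the intervals: the factors outside the k-th block are trivial,
    and the others lie in the interval groups. *)
Lemma mem_G_lam_k k g : relabel f0 (under g) == f0 -> g \in moves_in d (J_ lam k) ->
  g \in G_lam_k lam k.
Proof.
move=> fg gJ; rewrite (cut_prod fg); apply: group_prod => -[l i] _.
have [lk | lk] := eqVneq l k; last first.
  rewrite cut_eq1 ?group1 // => j fj; apply: (moves_inP _ _ gJ).
  by rewrite -fiber_label1 inE ffunE fj.
rewrite {l}lk; have [lt_i | ge_i] := ltnP i (size (lam k)); last first.
  rewrite cut_eq1 ?group1 // => j fj.
  have : j \in K_label (k, i) by rewrite -f0K inE fj.
  by move/K_label_size; rewrite ltnNge ge_i.
have /subsetP sub : G_K (Ordinal lt_i) \subset G_lam_k lam k.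
  by rewrite /G_lam_k bigprodGE; apply/sub_gen/(bigcup_max (Ordinal lt_i)).
apply/sub/(subsetP (moves_in_G_K _)); rewrite -K_labelE -f0K.
exact: cut_moves_in.
Qed.

Lemma cut_mem_G_lam_k k g : relabel f0 (under g) == f0 ->
  cut (label1 f0) g k \in G_lam_k lam k.
Proof.
move=> fg; apply: mem_G_lam_k; last by rewrite -fiber_label1 cut_moves_in.
apply/relabel_fixP => i; rewrite /= restr_fiberE ?relabel_label1 //.
by case: ifP => // _; apply: relabel_fixP fg i.
Qed.

(** The Young subgroup is the stabilizer of the standard labelling, for the
    action through the underlying permutation. *)
Lemma mem_G_lam g : (g \in G_lam lam) = (relabel f0 (under g) == f0).
Proof.
apply/idP/idP => [| fg]; last first.
  rewrite (cut_prod (relabel_label1 fg)); apply: group_prod => k _.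
  apply: subsetP (cut_mem_G_lam_k k fg).
  by rewrite /G_lam bigprodGE; apply/sub_gen/(bigcup_max k).
have st_group : group_set [set h : W | relabel f0 (under h) == f0].
  apply/group_setP; split=> [|h h']; rewrite !inE ?relabel1 //.
  by move=> /eqP fh /eqP fh'; rewrite relabelM fh' fh.
suff /subsetP sub : G_lam lam \subset Group st_group by move/sub; rewrite inE.
rewrite /G_lam bigprodGE gen_subG; apply/bigcupsP => k _.
rewrite /G_lam_k bigprodGE gen_subG; apply/bigcupsP => i _.
apply/subsetP => h /(subsetP (G_K_moves i)) hK; rewrite inE.
have lt_i : (i < n.+1)%N by apply: leq_trans (size_dpart lam k).
have K_E : K_ i = fiber f0 (k, Ordinal lt_i) by rewrite f0K.
apply/relabel_fixP => j; have [jK | /(moves_inP _ _ hK)[_ -> //]] := boolP (j \in K_ i).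
have := moves_in_stable hK jK; move: jK.
by rewrite K_E !inE => /eqP -> /eqP.
Qed.

Variables (zeta : algC) (zetaP : d.+1.-primitive_root zeta) (beta : 'I_d.+1 -> one_dim).

Lemma zeta_ordD (k : nat) (a b : 'I_d.+1) :
  zeta ^+ (k * (a + b)%R) = zeta ^+ (k * a) * zeta ^+ (k * b).
Proof.
by rewrite mulnC exprM prim_expr_mod // -exprM -exprD mulnC mulnDr.
Qed.

Lemma zeta_sum (I : Type) (r : seq I) (k : nat) (c : I -> 'I_d.+1) :
  zeta ^+ (k * (\sum_(i <- r) c i)%R) = \prod_(i <- r) zeta ^+ (k * c i).
Proof.
elim/big_rec2: _ => [|i y z _ <-]; first by rewrite muln0.
by rewrite zeta_ordD.
Qed.

(** The components of g in the internal direct product are its cuts along the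
    blocks J_k; the exponents of zeta then add up position by position. *)
Lemma tensor_char_G_lam g : relabel f0 (under g) == f0 ->
  tensor_char zetaP lam beta g =
  (\prod_i zeta ^+ (label1 f0 i * color g i)) * beta_weight beta (label1 f0) (under g).
Proof.
move=> fg; have kg := relabel_label1 fg.
rewrite {1}(cut_prod kg) tensor_charE => [|k]; last exact: cut_mem_G_lam_k.
rewrite /beta_weight (eq_bigr (fun k =>
  (\prod_(i in fiber (label1 f0) k) zeta ^+ (k * color g i)) *
  one_dim_val (beta k) (restr_perm (fiber (label1 f0) k) (under g)))).
  rewrite big_split /=; congr (_ * _).
  rewrite [RHS](partition_big (label1 f0) predT) //=; apply: eq_bigr => k _.
  apply: eq_big => [i | i]; first by rewrite inE.
  by rewrite inE => /eqP ->.
move=> k _; rewrite cfunE /delta_val /color_sum zeta_sum; congr (_ * _).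
rewrite [RHS]big_mkcond; apply: eq_bigr => i _.
by rewrite /= ffunE inE; case: ifP; rewrite ?muln0.
Qed.

End YoungSubgroup.

(** * The left-hand side as a sum over labellings *)

Lemma relabel_fixV (T L : finType) (f : {ffun T -> L}) (w : {perm T}) :
  (relabel f w^-1%g == f) = (relabel f w == f).
Proof.
by apply/eqP/eqP => fw; rewrite -[in LHS]fw -relabelM ?mulgV ?mulVg relabel1.
Qed.

Lemma label1_relabel (T D P : finType) (f : {ffun T -> D * P}) (v : {perm T}) :
  label1 (relabel f v) = relabel (label1 f) v.
Proof. by apply/ffunP => i; rewrite !ffunE. Qed.

Section BetaWeight.
Variables (d n : nat) (beta : 'I_d.+1 -> one_dim).
Implicit Types (kappa : {ffun 'I_n.+1 -> 'I_d.+1}) (v w : 'S_n.+1).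

Lemma beta_weightV kappa w : relabel kappa w == kappa ->
  beta_weight beta kappa w^-1%g = beta_weight beta kappa w.
Proof.
move=> kw; apply: eq_bigr => k _.
by rewrite morphV ?fiber_stable // one_dim_valV.
Qed.

Lemma beta_weightJ kappa v w : relabel kappa (w ^ v)%g == kappa ->
  beta_weight beta kappa (w ^ v)%g = beta_weight beta (relabel kappa v) w.
Proof.
move=> kwv; apply: eq_bigr => k _.
rewrite -[RHS](one_dim_valJ _ _ v); congr one_dim_val; apply/permP => i.
rewrite -(permKV v i) permJ !restr_fiberE -?relabel_fixJ // permJ ffunE.
by case: ifP.
Qed.

End BetaWeight.

Section WreathImmanant.
Variables (d n : nat) (zeta : algC) (zetaP : d.+1.-primitive_root zeta).
Variables (lam : dpartition d n) (beta : 'I_d.+1 -> one_dim).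
Local Notation W := (wreath d n).
Local Notation label := ('I_d.+1 * 'I_n.+1)%type.

Lemma sum_wreath (V : nmodType) (F : W -> V) :
  \sum_g F g = \sum_(w : 'S_n.+1) \sum_(c : {ffun 'I_n.+1 -> 'I_d.+1}) F (Wreath c w).
Proof.
rewrite exchange_big pair_bigA /= (reindex (@pair_wreath d n)) //=.
by exists (@wreath_pair d n) => [[c w] _ | [c w] _].
Qed.

Lemma zeta_neq0 : zeta != 0.
Proof.
apply/eqP => z0; have := prim_expr_order zetaP.
by rewrite z0 expr0n => /esym/eqP; rewrite oner_eq0.
Qed.

Lemma zeta_ordN (k : nat) (a : 'I_d.+1) : zeta ^+ (k * (- a)%R) = zeta ^- (k * a).
Proof.
apply: (can_inj (@mulrK _ (zeta ^+ (k * a)) _)).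
  by rewrite unitfE expf_neq0 // zeta_neq0.
rewrite -zeta_ordD // addNr muln0 mulVf //.
by rewrite expf_neq0 // zeta_neq0.
Qed.

Lemma colorV (g : W) i : color g^-1%g i = - color g ((under g)^-1%g i).
Proof. by rewrite ffunE. Qed.

Lemma underV (g : W) : under g^-1%g = (under g)^-1%g. Proof. by []. Qed.

(** The contribution of f to the monomial character at the inverse of
    Wreath c w. *)
Definition labelled_term (c : {ffun 'I_n.+1 -> 'I_d.+1}) (w : 'S_n.+1) (f : {ffun 'I_n.+1 -> label}) : algC :=
  (relabel f w == f)%:R *
  ((\prod_i zeta ^- (c i * label1 f i)) * beta_weight beta (label1 f) w).

(** The color of g^-1 ^ y at the position under y (under g j) is
    - color y (under g j) - color g j + color y j.  As under g preserves f, the two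
    contributions of y cancel in the product over j, and the value depends on y
    only through the labelling it produces. *)
Lemma tensor_char_conj (f0 : {ffun 'I_n.+1 -> label}) (g y : W) :
    (forall l, fiber f0 l = K_label lam l) ->
  tensor_char zetaP lam beta (g^-1 ^ y)%g =
  labelled_term (color g) (under g) (relabel f0 (under y)).
Proof.
move=> f0K; set f := relabel f0 _; set w := under g.
have underJ : under (g^-1 ^ y)%g = (w^-1 ^ under y)%g by [].
have fixE : (relabel f0 (under (g^-1 ^ y)%g) == f0) = (relabel f w == f).
  by rewrite underJ relabel_fixJ relabel_fixV.
rewrite /labelled_term -fixE; have [fg | fg] := boolP (relabel f0 _ == f0); last first.
  by rewrite cfun0 ?mul0r // (mem_G_lam f0K).
rewrite mul1r (tensor_char_G_lam f0K) //.
have kg := relabel_label1 fg; rewrite fixE in fg.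
have kw : relabel (label1 f) w == label1 f by apply: relabel_label1.
congr (_ * _); last first.
  by rewrite underJ beta_weightJ // -label1_relabel beta_weightV.
pose Z i (c : {ffun 'I_n.+1 -> 'I_d.+1}) := zeta ^+ (label1 f i * c i).
have Z0 i c : Z i c != 0 by rewrite expf_neq0 // zeta_neq0.
(* Reindex by the position under y (w j), so that the colors of g and y are
   read off at positions of f. *)
rewrite (reindex_inj (@perm_inj _ (w * under y)%g)).
rewrite (eq_bigr (fun j => (Z (w j) (color y))^-1 * (Z j (color g))^-1 * Z j (color y))).
  rewrite !big_split /= mulrAC -(reindex_inj (@perm_inj _ w) (P := xpredT) (F := fun j => (Z j (color y))^-1)).
  rewrite -big_split big1 ?mul1r => [|j _]; last by rewrite /= mulVf.
  by apply: eq_bigr => j _; rewrite mulnC.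
move=> j _; have k_v i : label1 f0 (under y i) = label1 f i by rewrite !ffunE.
rewrite conjgE !colorM !colorV !underV !permM !permK k_v.
rewrite !zeta_ordD // !zeta_ordN // mulrA /Z.
by rewrite (relabel_fixP _ _ kw).
Qed.

(** The sum over conjugators y splits into the colors, which contribute a
    constant factor, and the permutations, to which sum_relabel applies.  The order
    of the Young subgroup has the same two factors. *)
Lemma wreath_monomial_charV (g : W) :
  wreath_monomial_char zetaP lam beta g^-1%g =
  \sum_(f | has_type lam f) labelled_term (color g) (under g) f.
Proof.
have [f0 f0K] := std_labelling lam.
rewrite /wreath_monomial_char cfIndE ?subsetT //.
rewrite (eq_bigr (fun y => labelled_term (color g) (under g) (relabel f0 (under y)))); last first.
  by move=> y _; apply: tensor_char_conj.
rewrite (eq_bigl xpredT) => [|y]; last by rewrite inE.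
pose N := #|{ffun 'I_n.+1 -> 'I_d.+1}|.
have sum_under (V : nmodType) (F : 'S_n.+1 -> V) : \sum_(y : W) F (under y) = (\sum_w F w) *+ N.
  by rewrite sum_wreath -sumrMnl; apply: eq_bigr => w _; rewrite /= sumr_const.
rewrite (sum_under _ (fun v => labelled_term _ _ (relabel f0 v))) sum_relabel.
have card_G : #|G_lam lam| = (#|[set v : 'S_n.+1 | relabel f0 v == f0]| * N)%N.
  rewrite -!sum1_card big_mkcond [in RHS]big_mkcond /=.
  under eq_bigr do rewrite (mem_G_lam f0K).
  rewrite (sum_under _ (fun v => if relabel f0 v == f0 then 1%N else 0%N)).
  by under [in RHS]eq_bigr do rewrite inE; rewrite -mulr_natr natn.
rewrite -mulrnA -card_G -[X in _ * X]mulr_natl mulKf ?pnatr_eq0 -?lt0n ?cardG_gt0 //.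
by apply: eq_bigl => f; apply: eq_forallb => l; rewrite f0K card_K_label.
Qed.

Variables (A : comAlgType algC) (x : 'I_n.+1 -> colored d n -> A).

(** For fixed f and w, the sum over all colorings of a product over positions
    is the product over positions of the sums over one color, which are the entries
    of the matrices Q_k. *)
Lemma wreath_Imm_labelled :
  wreath_Imm (wreath_monomial_char zetaP lam beta) x =
  labelled_sum lam beta (Qmx zeta x).
Proof.
rewrite /wreath_Imm sum_wreath.
under eq_bigr => w _ do under eq_bigr => c _ do
  rewrite wreath_monomial_charV scaler_suml.
under eq_bigr => w _ do rewrite exchange_big.
rewrite exchange_big; apply: eq_bigr => f _.
rewrite [RHS]big_mkcond; apply: eq_bigr => w _.
case fw: (relabel f w == f); last first.
  by rewrite big1 // => c _; rewrite /labelled_term /= fw mul0r scale0r.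
under [in RHS]eq_bigr => i _ do rewrite mxE.
rewrite bigA_distr_bigA scaler_sumr; apply: eq_bigr => c _.
rewrite scaler_prod scalerA /labelled_term /= fw mul1r mulrC.
by congr (_ *: _).
Qed.

End WreathImmanant.

Theorem theorem3p1 (d n : nat) (zeta : algC)
    (zetaP : d.+1.-primitive_root zeta)
    (lam : dpartition d n) (beta : 'I_d.+1 -> one_dim) :
  wreath_Imm (wreath_monomial_char zetaP lam beta) (@xvar d n) =
  \sum_(I : {ffun 'I_d.+1 -> {set 'I_n.+1}}
         | ordered_set_partition (fun k => sumn (lam k)) I)
    \prod_(k < d.+1)
      Imm (sym_monomial_char #|I k| (lam k) (beta k))
          (principal_submx (Qmx zeta (@xvar d n) k) (I k)).
Proof. by rewrite sum_prod_Imm; apply: wreath_Imm_labelled. Qed.
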